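(* Let $(W,S)$ be a Coxeter group, let $n\ge 2$ be an integer, let $A$ be a $\mathbb{Z}[W]$-module and let $\zeta\in Z^n(W,A)$ be a collapsing cocycle. Then there exists a unique $W$-equivariant homomorphism $a:\mathbb{Z}[\mathcal{D}]^{\varepsilon(n)}\to A$ such that $\zeta=a\circ Z^W_n$.
   Context: $|\cdot|$ is the length function of $(W,S)$. $Z^n(W,A)$ denotes inhomogeneous $n$-cocycles: functions $\zeta:W^n\to A$ with $\delta\zeta=0$, where $(\delta\zeta)(x_1,\dots,x_{n+1})=x_1\zeta(x_2,\dots,x_{n+1})+\sum_{j=1}^n(-1)^j\zeta(x_1,\dots,x_jx_{j+1},\dots,x_{n+1})+(-1)^{n+1}\zeta(x_1,\dots,x_n)$. For $n\ge2$, a cocycle $\zeta\in Z^n(W,A)$ is collapsing if $\zeta(x_1,\dots,x_n)=0$ whenever $|x_ix_{i+1}|=|x_i|+|x_{i+1}|$ for some $1\le i\le n-1$. Geometry: let $E=\mathbb{R}^S$ with basis $\{e_s\}_{s\in S}$ and dual $E^*$. $W$ acts on $E$ by the standard geometric representation ($s(x)=x-2B(e_s,x)e_s$, where $B$ is the symmetric bilinear form with $B(e_s,e_t)=-\cos(\pi/m_{s,t})$, interpreted as $-1$ if the order $m_{s,t}$ of $st$ is infinite) and contragrediently on $E^*$. For $s\in S$ let $H_s=\ker(e_s)\subset E^*$, the hyperplane fixed by $s$. A wall is a hyperplane $w\cdot H_s$ ($w\in W$, $s\in S$); $\mathcal{H}$ is the set of walls. For $H\in\mathcal{H}$, the two connected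 components of $E^*-H$ are called reflecting half-spaces; $\mathcal{D}$ is the set of all reflecting half-spaces. Let $C_0=\{x\in E^*:\langle x,e_s\rangle>0\ \forall s\in S\}$; chambers are the $W$-translates of $C_0$. Let $\sigma:\mathcal{D}\to\mathcal{D}$, $\sigma(D)=E^*-\overline{D}$. For a chamber $C$ and $D\in\mathcal{D}$ put $v_D(C)=1$ if $C\subset D$ and $v_D(C)=0$ if $C\subset\sigma(D)$. $\mathbb{Z}[\mathcal{D}]$ is the free abelian group with basis $[D]$, $D\in\mathcal{D}$, with its $W$-action and involution $\sigma$; $\mathbb{Z}[\mathcal{D}]^{+}$ (resp. $\mathbb{Z}[\mathcal{D}]^{-}$) is the $\mathbb{Z}[W]$-submodule of elements $a$ with $\sigma(a)=a$ (resp. $\sigma(a)=-a$). $\varepsilon(n)=+$ if $n$ is even and $-$ if $n$ is odd. Define $Z^W_n:W^n\to\mathbb{Z}[\mathcal{D}]$ by $Z^W_n(x_1,\dots,x_n)=\sum_{D\in\mathcal{D}}\Big(\prod_{i=0}^{n-1}(v_D(C_i)-v_D(C_{i+1}))\Big)[D]$, where $C_i=x_1\cdots x_iC_0$ for $0\le i\le n$; it takes values in $\mathbb{Z}[\mathcal{D}]^{\varepsilon(n)}$ and is a cocycle. *)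

(* Defs.v *)
From HB Require Import structures.
From mathcomp Require Import all_boot all_order all_algebra finmap.
From mathcomp Require Import all_classical all_reals all_analysis.
(* The notations of monalg clash with those of mathcomp-analysis. Below,       *)
(* malg K G is the module of finitely supported functions K -> G, mcoeff k a   *)
(* is the coefficient of a at k, and mkmalgU k x is the element x [k].         *)
From mathcomp Require Import -(notations) monalg.

Set Implicit Arguments.
Unset Strict Implicit.
Unset Printing Implicit Defensive.

Import Order.TTheory GRing.Theory Num.Theory.
Import numFieldNormedType.Exports.

Local Open Scope classical_set_scope.
Local Open Scope ring_scope.

(* 0 if no natural number satisfies P *)
Definition least (P : pred nat) : nat :=
  if pselect (exists m, P m) is left ex then ex_minn ex else 0%N.

(* 0 if g has infinite order *)
Definition group_order (G : groupType) (g : G) : nat :=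
  least (fun m => (0 < m)%N && (g ^+ m == 1)%g).

(* The product of a word in the letters S. *)
Definition word_prod (W : groupType) (S : set W) (ws : seq (set_type S)) : W :=
  (\prod_(s <- ws) val s)%g.

(* The elements of S are involutions, so S generates W as soon as it does so   *)
(* as a monoid. The last clause says, by the universal property, that          *)
(* < S | (s t) ^ m(s, t) = 1 whenever m(s, t) is finite > is a presentation    *)
(* of W; the relation is void if m(s, t) is infinite, i.e., group_order is 0.  *)
Definition coxeter_system (W : groupType) (S : set W) : Prop :=
  [/\ forall s : set_type S, group_order (val s) = 2%N,
      forall w : W, exists ws : seq (set_type S), w = word_prod ws
    & forall (G : groupType) (f : set_type S -> G),
        (forall s t, (f s * f t) ^+ group_order (val s * val t) = 1)%g ->
        exists phi : {multiplicative W -> G}, forall s, phi (val s) = f s].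

Definition coxeter_length (W : groupType) (S : set W) (w : W) : nat :=
  least (fun m => `[< exists2 ws : seq (set_type S),
                        size ws = m & word_prod ws = w >]).

(* The data making the abelian group A a Z[W]-module. *)
Definition group_module (W : groupType) (A : zmodType) (act : W -> A -> A) :=
  [/\ forall a, act 1%g a = a,
      forall x y a, act (x * y)%g a = act x (act y a)
    & forall x a b, act x (a + b) = act x a + act x b].

Section Cochains.
Variables (W : groupType) (A : zmodType) (act : W -> A -> A).

(* (x_1, ..., x_{n+1}) |-> (x_1, ..., x_j x_{j+1}, ..., x_{n+1}), where the    *)
(* 0-based j : 'I_n stands for the index j + 1 of the formula.                 *)
Definition merge_face n (j : 'I_n) (x : n.+1.-tuple W) : n.-tuple W :=
  [tuple let xi := tnth x (widen_ord (leqnSn n) i) in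
         let xi1 := tnth x (lift ord0 i) in
         if (i < j)%N then xi else if i == j then (xi * xi1)%g else xi1
  | i < n].

Definition coboundary n (zeta : n.-tuple W -> A) (x : n.+1.-tuple W) : A :=
  act (thead x) (zeta [tuple tnth x (lift ord0 i) | i < n])
  + \sum_(j < n) zeta (merge_face j x) *~ (-1) ^+ j.+1
  + zeta [tuple tnth x (widen_ord (leqnSn n) i) | i < n] *~ (-1) ^+ n.+1.

Definition cocycle n (zeta : n.-tuple W -> A) : Prop :=
  forall x, coboundary zeta x = 0.

Definition collapsing (S : set W) n (zeta : n.-tuple W -> A) : Prop :=
  forall (x : n.-tuple W) (i j : 'I_n), j = i.+1 :> nat ->
    coxeter_length S (tnth x i * tnth x j)%g =
      (coxeter_length S (tnth x i) + coxeter_length S (tnth x j))%N ->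
    zeta x = 0.

End Cochains.

Section Geometry.
Variables (R : realType) (W : groupType) (S : set W).

(* The real vector space with basis (e_s), for S finite or infinite. *)
Definition cox_space := malg (set_type S) R.
HB.instance Definition _ := GRing.Lmodule.on cox_space.

Definition simple_root (s : set_type S) : cox_space := mkmalgU s 1.

Definition cox_coef (s t : set_type S) : R :=
  if group_order (val s * val t)%g is m.+1 then - cos (pi / m.+1%:R) else -1.

Definition cox_form (x y : cox_space) : R :=
  \sum_(s <- msupp x) \sum_(t <- msupp y)
    mcoeff s x * mcoeff t y * cox_coef s t.

(* For a Coxeter system, exactly one rho satisfies these conditions. *)
Definition is_geometric_rep (rho : W -> {linear cox_space -> cox_space}) :=
  [/\ forall x, rho 1%g x = x,
      forall v w x, rho (v * w)%g x = rho v (rho w x)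
    & forall (s : set_type S) x,
        rho (val s) x =
          x - (2 * cox_form (simple_root s) x) *: simple_root s].

Definition geometric_rep : W -> {linear cox_space -> cox_space} :=
  xget (fun=> idfun : {linear cox_space -> cox_space}) is_geometric_rep.

(* The dual of cox_space, with the topology of pointwise convergence (the      *)
(* usual topology if S is finite).                                             *)
Definition dual_space : topologicalType :=
  initial_topology (fun f : {linear cox_space -> R^o} =>
                      (f : cox_space -> R) : {ptws cox_space -> R}).

Definition pairing (f : dual_space) (x : cox_space) : R :=
  (f : {linear cox_space -> R^o}) x.

Definition dual_act (w : W) (f : dual_space) : dual_space :=
  (f : {linear cox_space -> R^o}) \o geometric_rep w^-1%g.

Definition simple_wall (s : set_type S) : set dual_space :=
  [set f | pairing f (simple_root s) = 0].

Definition walls : set (set dual_space) :=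
  [set H | exists w s, H = dual_act w @` simple_wall s].

Definition half_spaces : set (set dual_space) :=
  [set D | exists2 H, walls H
         & exists2 f, (~` H) f & D = connected_component (~` H) f].

Definition opposite (D : set dual_space) : set dual_space := ~` closure D.

Definition chamber (w : W) : set dual_space :=
  dual_act w @` [set f | forall s, 0 < pairing f (simple_root s)].

(* A chamber C lies either in D or in opposite D, for D in half_spaces. *)
Definition side (D C : set dual_space) : int :=
  if `[< C `<=` D >] then 1 else 0.

(* Z[half_spaces] is the group of the elements of free_sets supported in       *)
(* half_spaces; W and the involution D |-> opposite D act on it by linear      *)
(* extension.                                                                  *)
Definition free_sets := malg (set dual_space) int.
HB.instance Definition _ := GRing.Zmodule.on free_sets.

Definition free_map (g : set dual_space -> set dual_space) (a : free_sets) :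
    free_sets :=
  \sum_(D <- msupp a) mkmalgU (g D) (mcoeff D a).

Definition free_act (w : W) : free_sets -> free_sets :=
  free_map (fun D => dual_act w @` D).

Definition signed_pred (n : nat) : {pred free_sets} :=
  fun a => `[< [set` msupp a] `<=` half_spaces /\
               free_map opposite a = if odd n then - a else a >].

Lemma free_mapE g (a : free_sets) (X : {fset set dual_space}) :
  (msupp a `<=` X)%fset ->
  free_map g a = \sum_(D <- X) mkmalgU (g D) (mcoeff D a).
Proof.
move=> aX; apply: big_fset_incl => // D _ Da.
by rewrite mcoeff_outdom// raddf0.
Qed.

Lemma free_mapB g : {morph free_map g : a b / a - b}.
Proof.
move=> a b; pose X := (msupp a `|` msupp b)%fset.
rewrite (@free_mapE _ (a - b) X) ?msuppB_le//.
rewrite (@free_mapE _ a X) ?fsubsetUl// (@free_mapE _ b X) ?fsubsetUr//.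
by rewrite -sumrB; apply: eq_bigr => D _; rewrite !raddfB.
Qed.

Lemma signed_zmod_closed n : zmod_closed (signed_pred n).
Proof.
split=> [|a b].
  apply/asboolP; split=> [D /=|]; first by rewrite msupp0 inE.
  by rewrite /free_map msupp0 big_seq_fset0 oppr0 if_same.
move=> /asboolP[ha ea] /asboolP[hb eb]; apply/asboolP; split=> [D /= Dab|].
  have := fsubsetP (msuppB_le a b) D Dab.
  by rewrite in_fsetU => /orP[/ha|/hb].
by rewrite free_mapB ea eb; case: odd => //; rewrite opprD.
Qed.
HB.instance Definition _ n :=
  GRing.isZmodClosed.Build _ (signed_pred n) (signed_zmod_closed n).

(* Z[half_spaces]^+ for n even, Z[half_spaces]^- for n odd *)
Record signed_half_spaces (n : nat) := SignedHalfSpaces {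
  signed_val :> free_sets;
  signed_valP : signed_val \in signed_pred n
}.

HB.instance Definition _ n := [isSub for @signed_val n].
HB.instance Definition _ n := [Choice of signed_half_spaces n by <:].
HB.instance Definition _ n :=
  [SubChoice_isSubZmodule of signed_half_spaces n by <:].

(* The sum is finite, as only finitely many half-spaces have a nonzero         *)
(* coefficient; \sum_(D \in _) would be 0 otherwise.                           *)
Definition geometric_cocycle n (x : n.-tuple W) : free_sets :=
  let C i := chamber (\prod_(y <- take i x) y)%g in
  \sum_(D \in half_spaces)
    mkmalgU D (\prod_(i < n) (side D (C i) - side D (C i.+1))).

(* W preserves the submodule signed_half_spaces n of free_sets, and the values *)
(* of geometric_cocycle belong to it. So the element y below exists, and it is *)
(* w . u, resp. the value of the cocycle, seen in the submodule.               *)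
Definition equivariant (A : zmodType) (act : W -> A -> A) n
    (a : signed_half_spaces n -> A) : Prop :=
  forall w u, exists2 y : signed_half_spaces n,
    signed_val y = free_act w (signed_val u) & a y = act w (a u).

Definition factorization (A : zmodType) n (zeta : n.-tuple W -> A)
    (a : signed_half_spaces n -> A) : Prop :=
  forall x, exists2 y : signed_half_spaces n,
    signed_val y = geometric_cocycle x & zeta x = a y.

End Geometry.

(* Main.v *)
From HB Require Import structures.
Require Import Defs.
From mathcomp Require Import all_boot all_order all_algebra finmap.
From mathcomp Require Import all_classical all_reals all_analysis.
From mathcomp Require Import -(notations) monalg.
From mathcomp Require Import zify ring.

(** Written homogeneously, a collapsing [n]-cocycle is an equivariant function
    [z(g_0, ..., g_n)] that satisfies the cocycle relation and vanishes as soon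
    as some [g_i], [0 < i < n], lies on a geodesic of the word metric from
    [g_(i-1)] to [g_(i+1)]. If [h] lies on a geodesic from [g_i] to [g_(i+1)],
    the cocycle relation therefore reduces to three terms:

      [z(.., g_i, g_(i+1), ..) = z(.., h, g_(i+1), ..) + z(.., g_i, h, ..)]

    (lemma [homog_insert]), where [h] replaces [g_i], resp. [g_(i+1)].
    Subdividing a geodesic from [g_0] to [g_1] writes [z] as a sum of values
    [z(p, p s, g_2, ..)] over its edges. If [g_2] is on the side of [p s] of the
    wall between [p] and [p s], such a term vanishes; otherwise [p] lies on a
    geodesic from [p s] to [g_2]; inserting it gives [z(p, p s, p, g_3, ..)],
    the other term being degenerate. Iterating, the term is
    [z(p, p s, p, p s, ..)] if the vertices alternate about that wall, and [0]
    otherwise ([homog_zigzag], [homog_gallery]). The same computation of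
    [z(p, u t, u, u t, u, ..)] along two geodesics shows that
    [z(p, p s, p, ..)] depends only on the half-space that the edge from [p] to
    [p s] leaves ([edge_val_wd]); call it [c(D)]. Then [c] is equivariant and
    [c(opposite D) = (-1)^n c(D)], and [z(g_0, ..., g_n)] is the sum of the
    [c(D)] over the half-spaces [D] that contain [g_0] and about which the
    [g_i] alternate ([homog_half]). For these [D] the coefficient of [D] in the
    geometric cocycle is [(-1)^(n/2)], so that the map sending [x] to
    [(-1)^(n/2)] times the sum of the [x_D c(D)], with one [D] in each pair of
    opposite half-spaces, is the required one ([wall_map]). It is unique because
    the geometric cocycle at [(s, ..., s)] is, up to sign,
    [D + (-1)^n opposite D]
    for [D] the half-space of [e_s], and the [W]-translates of these elements
    generate the module.

    This uses two facts about half-spaces: a geodesic crosses exactly the walls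
    separating its ends, each once ([left_halvesP], [left_halves_uniq]), and the
    half-space of [u e_s] contains the chamber of [w] exactly when [w] is closer
    to [u] than to [u s] ([contains_root_half]). Both follow from the fact that
    the root [w e_s] is nonnegative unless [s] shortens [w] ([root_nonneg]),
    which is proved by induction on the length of [w] with an explicit
    computation in the plane of two simple roots; the same computation gives the
    existence of the geometric representation. *)

Set Implicit Arguments.
Unset Strict Implicit.
Unset Printing Implicit Defensive.

Import Order.TTheory GRing.Theory Num.Theory.
Import numFieldNormedType.Exports.

Local Open Scope classical_set_scope.
Local Open Scope ring_scope.

(** * Orders and word length *)

Lemma leastP (P : pred nat) : (exists m, P m) ->
  P (least P) /\ forall m, P m -> (least P <= m)%N.
Proof.
move=> exP; rewrite /least; case: pselect => // ex.
by case: ex_minnP.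
Qed.

Lemma expg_group_order (G : groupType) (g : G) : (g ^+ group_order g = 1)%g.
Proof.
rewrite /group_order /least; case: pselect => [ex|_]; last by rewrite expg0.
by case: ex_minnP => m /andP[_ /eqP].
Qed.

(** [altword i j k] is the alternating word of length [k] in the letters [i]
    and [j] whose last letter is [j]. *)
Fixpoint altword (I : Type) (i j : I) (k : nat) : seq I :=
  if k is k'.+1 then (if odd k' then i else j) :: altword i j k' else [::].

Lemma size_altword (I : Type) (i j : I) k : size (altword i j k) = k.
Proof. by elim: k => //= k ->. Qed.

Lemma altword_rcons (I : Type) (i j : I) k :
  altword i j k.+1 = rcons (altword j i k) j.
Proof.
by elim: k => // k IH; rewrite /= -IH /=; case: (odd k).
Qed.

Section Length.
Variables (W : groupType) (S : set W).
Hypothesis hS : coxeter_system S.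
Local Notation len := (coxeter_length S).
Implicit Types (s t : set_type S) (v w x y : W) (ws : seq (set_type S)).

Lemma gen_sqr s : (val s * val s = 1)%g.
Proof.
case: hS => ord2 _ _; move: (expg_group_order (val s)).
by rewrite ord2 expgS expg1.
Qed.

Lemma gen_inv s : ((val s)^-1 = val s)%g.
Proof. by apply: (mulgI (val s)); rewrite mulgV gen_sqr. Qed.

Lemma mulg_genK w s : (w * val s * val s = w)%g.
Proof. by rewrite -mulgA gen_sqr mulg1. Qed.

Lemma word_prod_cons s ws : word_prod (s :: ws) = (val s * word_prod ws)%g.
Proof. by rewrite /word_prod big_cons. Qed.

Lemma word_prod_cat ws ws' :
  word_prod (ws ++ ws') = (word_prod ws * word_prod ws')%g.
Proof. by rewrite /word_prod big_cat. Qed.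

Lemma word_prod_rev ws : word_prod (rev ws) = ((word_prod ws)^-1)%g.
Proof.
elim: ws => [|s ws IH]; first by rewrite /word_prod !big_nil invg1.
rewrite rev_cons -cats1 word_prod_cat IH !word_prod_cons invgM gen_inv.
by rewrite {2}/word_prod big_nil mulg1.
Qed.

Let len_spec w :
  (exists2 ws : seq (set_type S), size ws = len w & word_prod ws = w) /\
  forall ws : seq (set_type S), word_prod ws = w -> (len w <= size ws)%N.
Proof.
have [|/asboolP ex mn] := @leastP (fun m => `[< exists2 ws : seq (set_type S),
    size ws = m & word_prod ws = w >]).
  by case: hS => _ /(_ w)[ws ->] _; exists (size ws); apply/asboolP; exists ws.
by split=> // ws wsE; apply: mn; apply/asboolP; exists ws.
Qed.

Lemma reduced_word w :
  exists2 ws : seq (set_type S), size ws = len w & word_prod ws = w.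
Proof. by have [] := len_spec w. Qed.

Lemma len_word ws : (len (word_prod ws) <= size ws)%N.
Proof. by have [_] := len_spec (word_prod ws); apply. Qed.

Lemma len1 : len 1%g = 0%N.
Proof. by have := len_word [::]; rewrite /word_prod big_nil leqn0 => /eqP. Qed.

Lemma len_eq0 w : len w = 0%N -> w = 1%g.
Proof.
have [ws sz wE] := reduced_word w => l0; move: sz.
rewrite l0 -wE => /size0nil ->; by rewrite /word_prod big_nil.
Qed.

Lemma lenM x y : (len (x * y)%g <= len x + len y)%N.
Proof.
have [u <- {1}<-] := reduced_word x; have [v <- {1}<-] := reduced_word y.
by rewrite -word_prod_cat -size_cat len_word.
Qed.

Lemma lenV x : len (x^-1)%g = len x.
Proof.
have le y : (len (y^-1)%g <= len y)%N.
  have [u <- {1}<-] := reduced_word y.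
  by rewrite -word_prod_rev -size_rev len_word.
by apply/eqP; rewrite eqn_leq le /= -{1}[x]invgK le.
Qed.

Lemma len_gen s : (len (val s) <= 1)%N.
Proof. by have := len_word [:: s]; rewrite /word_prod big_seq1. Qed.

Lemma lenM_gen w s : (len (w * val s)%g <= (len w).+1)%N.
Proof. by rewrite (leq_trans (lenM _ _))// -addn1 leq_add2l len_gen. Qed.

Lemma lenM_genV w s : (len w <= (len (w * val s)%g).+1)%N.
Proof. by rewrite -{1}(mulg_genK w s) lenM_gen. Qed.

Lemma last_letter w : (0 < len w)%N ->
  exists s : set_type S, (len (w * val s)%g).+1 = len w.
Proof.
have [ws] := reduced_word w; case/lastP: ws => [<- _ //|ws s].
rewrite size_rcons => sz wE _; exists s.
apply/eqP; rewrite eqn_leq lenM_genV andbT -sz ltnS -wE -cats1 word_prod_cat.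
by rewrite {2}/word_prod big_seq1 mulg_genK len_word.
Qed.

Local Notation P s t k := (word_prod (altword s t k)).

Lemma altprodS s t k :
  P s t k.+1 = (val (if odd k then s else t) * P s t k)%g.
Proof. exact: word_prod_cons. Qed.

Lemma altprodSr s t k : P s t k.+1 = (P t s k * val t)%g.
Proof.
by rewrite altword_rcons -cats1 word_prod_cat {2}/word_prod big_seq1.
Qed.

Lemma altprod_quot s t k : (P s t k * (P t s k)^-1 =
  (if odd k then val t * val s else val s * val t) ^+ k)%g.
Proof.
have conj (x y : W) j : (x * (y * x) ^+ j * y = (x * y) ^+ j.+1)%g.
  elim: j => [|j IH]; first by rewrite expg0 mulg1 expg1.
  by rewrite [in RHS]expgS -IH expgS !mulgA.
elim: k => [|k IH]; first by rewrite /word_prod !big_nil invg1 mulg1 expg0.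
rewrite !altprodS invgM gen_inv mulgA -(mulgA _ (P s t k)) IH /=.
by case: (odd k); rewrite /= conj.
Qed.

Lemma altprod_order s t : let m := group_order (val s * val t)%g in
  P s t m = P t s m.
Proof.
move=> /= ; set m := group_order _.
have e1 : ((val s * val t) ^+ m = 1)%g := expg_group_order _.
have e2 : ((val t * val s) ^+ m = 1)%g.
  have -> : (val t * val s = (val s * val t)^-1)%g by rewrite invgM !gen_inv.
  by rewrite expVgn e1 invg1.
have := altprod_quot s t m.
rewrite (_ : (if _ then _ else _) ^+ m = 1)%g; last by case: ifP.
by move/(canRL (mulgVK _)) => ->; rewrite mul1g.
Qed.

End Length.

(** * Linear automorphisms and reflections *)

(** The group of linear automorphisms of a module. The inverse is part of the
    data, and its linearity is a consequence of that of the map. *)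
Record linear_aut (K : nzRingType) (E : lmodType K) := LinearAut {
  aut_fun : E -> E;
  aut_inv : E -> E;
  aut_linear : linear aut_fun;
  aut_funK : cancel aut_fun aut_inv;
  aut_invK : cancel aut_inv aut_fun
}.

Section LinearAut.
Variables (K : nzRingType) (E : lmodType K).
Implicit Types f g h : linear_aut E.

Lemma linear_autP f g : aut_fun f =1 aut_fun g -> f = g.
Proof.
case: f g => [f f' fl fK f'K] [g g' gl gK g'K] /= fg.
have {fg}fg : f = g by apply/funext.
subst g; have fg' : f' = g' by apply/funext => x; rewrite -{1}(g'K x) fK.
by subst g'; congr LinearAut; exact: Prop_irrelevance.
Qed.

Let id_linear : linear (@idfun E). Proof. by []. Qed.
Let id_cancel : cancel (@idfun E) idfun. Proof. by []. Qed.
Definition aut_id := LinearAut id_linear id_cancel id_cancel.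

Let comp_linear f g : linear (aut_fun f \o aut_fun g).
Proof. by move=> a x y /=; rewrite !aut_linear. Qed.
Definition aut_comp f g :=
  LinearAut (comp_linear f g)
    (can_comp (@aut_funK _ _ f) (@aut_funK _ _ g))
    (can_comp (@aut_invK _ _ g) (@aut_invK _ _ f)).

Let inv_linear f : linear (aut_inv f).
Proof.
move=> a x y; apply: (can_inj (@aut_funK _ _ f)).
by rewrite aut_linear !aut_invK.
Qed.
Definition aut_opp f :=
  LinearAut (inv_linear f) (@aut_invK _ _ f) (@aut_funK _ _ f).

HB.instance Definition _ := gen_eqMixin (linear_aut E).
HB.instance Definition _ := gen_choiceMixin (linear_aut E).

Let aut_compA : associative aut_comp.
Proof. by move=> f g h; apply: linear_autP. Qed.
Let aut_comp1g : left_id aut_id aut_comp.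
Proof. by move=> f; apply: linear_autP. Qed.
Let aut_compg1 : right_id aut_id aut_comp.
Proof. by move=> f; apply: linear_autP. Qed.
Let aut_compVg : left_inverse aut_id aut_opp aut_comp.
Proof. by move=> f; apply: linear_autP => x /=; rewrite aut_funK. Qed.
Let aut_compgV : right_inverse aut_id aut_opp aut_comp.
Proof. by move=> f; apply: linear_autP => x /=; rewrite aut_invK. Qed.
HB.instance Definition _ := isGroup.Build (linear_aut E)
  aut_compA aut_comp1g aut_compg1 aut_compVg aut_compgV.

Lemma aut_funX f k x : aut_fun (f ^+ k)%g x = iter k (aut_fun f) x.
Proof. by elim: k => // k IH; rewrite expgS /= IH. Qed.

End LinearAut.

(** The linear functional on the module with basis [K] that takes the value
    [F k] at the basis vector [k]. *)
Section LinExt.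
Variables (R : comNzRingType) (K : choiceType) (F : K -> R).
Implicit Types x y : malg K R.

Definition lin_ext x : R := \sum_(k <- msupp x) mcoeff k x * F k.

Lemma lin_extE x (X : {fset K}) : (msupp x `<=` X)%fset ->
  lin_ext x = \sum_(k <- X) mcoeff k x * F k.
Proof.
move=> xX; apply: big_fset_incl => // k _ kx.
by rewrite mcoeff_outdom ?mul0r.
Qed.

Lemma lin_ext_linear a x y : lin_ext (a *: x + y) = a * lin_ext x + lin_ext y.
Proof.
pose X := (msupp x `|` msupp y `|` msupp (a *: x + y))%fset.
have xX : (msupp x `<=` X)%fset by rewrite /X -fsetUA fsubsetUl.
have yX : (msupp y `<=` X)%fset by rewrite /X fsetUAC fsubsetUr.
rewrite (lin_extE xX) (lin_extE yX) (@lin_extE _ X) ?fsubsetUr//.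
rewrite mulr_sumr -big_split /=; apply: eq_bigr => k _.
by rewrite mcoeffD mcoeffZ mulrDl mulrA.
Qed.

Lemma lin_extU k : lin_ext (mkmalgU k 1) = F k.
Proof.
rewrite (@lin_extE _ [fset k]%fset) ?msuppU_le// big_seq_fset1 mcoeffUU.
exact: mul1r.
Qed.

End LinExt.

(** The sequence with [cheb b 0 = 0], [cheb b 1 = 1] and
    [cheb b k.+2 = b * cheb b k.+1 - cheb b k]; it is [sin (k th) / sin th] if
    [b = 2 cos th] and [sin th] is nonzero. The pair [cheb2 b k] consists of the
    terms [k] and [k.+1]. *)
Fixpoint cheb2 (R : pzRingType) (b : R) (k : nat) : R * R :=
  if k is k'.+1 then let: (u, v) := cheb2 b k' in (v, b * v - u) else (0, 1).
Definition cheb (R : pzRingType) (b : R) k := (cheb2 b k).1.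

Section Cheb.
Variable R : realType.
Implicit Types (b th : R) (k m : nat).

Lemma cheb0 b : cheb b 0 = 0. Proof. by []. Qed.
Lemma cheb1 b : cheb b 1 = 1. Proof. by []. Qed.
Lemma chebSS b k : cheb b k.+2 = b * cheb b k.+1 - cheb b k.
Proof. by rewrite /cheb /=; case: cheb2. Qed.

Lemma cheb_ind (Q : nat -> Prop) :
  Q 0%N -> Q 1%N -> (forall k, Q k -> Q k.+1 -> Q k.+2) -> forall k, Q k.
Proof.
move=> Q0 Q1 QS k; suff [] : Q k /\ Q k.+1 by [].
by elim: k => [|k [Qk QSk]]; split=> //; apply: QS.
Qed.

Lemma cheb_nat k : cheb 2 k = k%:R :> R.
Proof.
elim/cheb_ind: k => // k IH IHS; rewrite chebSS IH IHS -!natr1; ring.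
Qed.

Lemma cheb_sin th k : cheb (2 * cos th) k * sin th = sin (k%:R * th).
Proof.
elim/cheb_ind: k => [||k IH IHS].
- by rewrite cheb0 !mul0r sin0.
- by rewrite cheb1 !mul1r.
rewrite chebSS mulrBl -(mulrA (2 * cos th)) IH IHS.
have -> : k%:R * th = k.+1%:R * th - th by rewrite -natr1; ring.
have -> : k.+2%:R * th = k.+1%:R * th + th by rewrite -(natr1 k.+1); ring.
by rewrite sinB sinD; ring.
Qed.

Section Angle.
Variable m : nat.
Hypothesis m_gt1 : (1 < m)%N.
Let th : R := pi / m%:R.
Let b := 2 * cos th.

Let m_gt0 : 0 < m%:R :> R. Proof. by rewrite ltr0n; lia. Qed.
Let mth : m%:R * th = pi. Proof. by rewrite /th mulrC divfK ?gt_eqF. Qed.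

Lemma sin_pi_div_gt0 : 0 < sin (pi / m%:R : R).
Proof.
apply: sin_gt0_pi; rewrite divr_gt0 ?pi_gt0//= ltr_pdivrMr// ltr_pMr ?pi_gt0//.
by rewrite ltr1n.
Qed.

Lemma cheb_pi_div_ge0 k : (k <= m)%N -> 0 <= cheb b k.
Proof.
move=> km; rewrite -(pmulr_lge0 _ sin_pi_div_gt0) -/th cheb_sin.
apply: sin_ge0_pi; rewrite mulr_ge0 ?divr_ge0 ?pi_ge0//= -mth.
by rewrite ler_wpM2r ?divr_ge0 ?pi_ge0// ler_nat.
Qed.

Lemma cheb_period0 : cheb b m.*2 = 0.
Proof.
apply: (mulIf (lt0r_neq0 sin_pi_div_gt0)); rewrite -/th cheb_sin mul0r.
by rewrite -addnn natrD mulrDl mth -mulr2n sin2pi.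
Qed.

Lemma cheb_period1 : cheb b m.*2.+1 = 1.
Proof.
apply: (mulIf (lt0r_neq0 sin_pi_div_gt0)); rewrite -/th cheb_sin mul1r.
rewrite -natr1 mulrDl mul1r -addnn natrD mulrDl mth -mulr2n addrC.
by rewrite sinD2pi.
Qed.

Lemma cheb_periodN1 : cheb b m.*2.-1 = -1.
Proof.
have := chebSS b m.*2.-1; rewrite prednK ?double_gt0 ?(ltnW m_gt1)//.
by rewrite cheb_period0 cheb_period1 mulr0 add0r => ->; rewrite opprK.
Qed.

End Angle.
End Cheb.

(** Reflections [x |-> x - 2 (form i x) e_i] attached to vectors [e_i] and
    linear functionals [form i] of a module. *)
Section Reflections.
Variables (R : realType) (V : lmodType R) (I : eqType).
Variables (e : I -> V) (form : I -> V -> R).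
Hypothesis form_linear : forall i a x y,
  form i (a *: x + y) = a * form i x + form i y.
Hypothesis form_diag : forall i, form i (e i) = 1.
Hypothesis form_sym : forall i j, form i (e j) = form j (e i).
Implicit Types (i j : I) (x y : V) (ws : seq I).

Definition reflection i x := x - (2 * form i x) *: e i.

Let form0 i : form i 0 = 0.
Proof.
by have := form_linear i (-1) 0 0; rewrite scaler0 addr0 mulN1r addNr.
Qed.

Let formZ i a x : form i (a *: x) = a * form i x.
Proof. by rewrite -[a *: x]addr0 form_linear form0 addr0. Qed.

Let formD i x y : form i (x + y) = form i x + form i y.
Proof. by rewrite -{1}[x]scale1r form_linear mul1r. Qed.

Lemma reflection_linear i : linear (reflection i).
Proof.
move=> a x y; rewrite /reflection form_linear mulrDr scalerDl scalerBr scalerA.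
by rewrite mulrCA !mulrA opprD addrACA (mulrC a 2) -mulrA.
Qed.

Lemma reflection_fix i x : form i x = 0 -> reflection i x = x.
Proof. by move=> x0; rewrite /reflection x0 mulr0 scale0r subr0. Qed.

Lemma reflectionZ i a x : reflection i (a *: x) = a *: reflection i x.
Proof.
by rewrite -[a *: x]addr0 reflection_linear (reflection_fix (form0 i)) addr0.
Qed.

Lemma reflection_basis i j :
  reflection i (e j) = e j + (- 2 * form i (e j)) *: e i.
Proof. by rewrite /reflection mulNr scaleNr. Qed.

Lemma reflection_diag i : reflection i (e i) = - e i.
Proof.
rewrite reflection_basis form_diag mulr1 scaleNr scaler_nat mulr2n opprD.
by rewrite addNKr.
Qed.

Lemma reflectionK i : involutive (reflection i).
Proof.
move=> x; rewrite {2}/reflection addrC -scaleNr reflection_linear.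
by rewrite reflection_diag scalerN scaleNr opprK /reflection addrC subrK.
Qed.

Lemma foldr_reflection_linear ws : linear (fun x => foldr reflection x ws).
Proof. by elim: ws => // i ws IH a x y; rewrite /= IH reflection_linear. Qed.

(** In the plane of [e i] and [e j], the alternating words act through the
    sequence [cheb]. *)
Lemma reflection_altword i j k : let b := - 2 * form i (e j) in
  foldr reflection (e i) (altword i j k) =
    cheb b k.+1 *: e (if odd k then j else i)
    + cheb b k *: e (if odd k then i else j).
Proof.
move=> b; have bC : b = - 2 * form j (e i) by rewrite /b form_sym.
elim: k => [|k IH]; first by rewrite scale1r scale0r addr0.
have step (x y : V) (u v : R) :
    u *: (x + b *: y) + v *: (- y) = (b * u - v) *: y + u *: x.
  by rewrite scalerDr scalerA scalerN scalerBl mulrC -addrA addrC.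
rewrite [LHS]/= IH chebSS [odd k.+1]/= reflection_linear reflectionZ.
case: (odd k) => /=.
- by rewrite reflection_diag reflection_basis -/b step.
- by rewrite reflection_diag reflection_basis -bC step.
Qed.

Lemma foldr_altwordSr i j k x : foldr reflection x (altword i j k.+1) =
  foldr reflection (reflection j x) (altword j i k).
Proof. by rewrite altword_rcons foldr_rcons. Qed.

Lemma iter_reflection2 i j k x :
  iter k (reflection i \o reflection j) x =
  foldr reflection x (altword i j k.*2).
Proof. by elim: k => //= k IH; rewrite IH odd_double. Qed.

Section FiniteOrder.
Variables (i j : I) (m : nat).
Hypotheses (m_gt1 : (1 < m)%N) (cosE : form i (e j) = - cos (pi / m%:R)).
Let rot := iter m (reflection i \o reflection j).
Let bE : - 2 * form i (e j) = 2 * cos (pi / m%:R).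
Proof. by rewrite cosE mulrNN. Qed.

Let rot_linear : linear rot.
Proof.
move=> a x y; rewrite /rot !iter_reflection2.
exact: foldr_reflection_linear.
Qed.

Let rot_l : rot (e i) = e i.
Proof.
rewrite /rot iter_reflection2 reflection_altword bE cheb_period0//.
by rewrite cheb_period1// odd_double scale1r scale0r addr0.
Qed.

Let rot_r : rot (e j) = e j.
Proof.
have m2 : (0 < m.*2)%N by rewrite double_gt0; apply: ltnW.
rewrite /rot iter_reflection2 -(prednK m2) foldr_altwordSr reflection_diag.
rewrite -scaleN1r -[_ *: _]addr0 foldr_reflection_linear.
have -> : foldr reflection 0 (altword j i m.*2.-1) = 0.
  by elim: (altword _ _ _) => //= l ws ->; rewrite reflection_fix.
rewrite addr0 reflection_altword -form_sym bE (prednK m2) cheb_period0//.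
rewrite cheb_periodN1// -subn1 oddB// odd_double /=.
by rewrite scale0r add0r scaleN1r scaleN1r opprK.
Qed.

(** The product of the two reflections has order dividing [m]. It does so on the
    plane of [e i] and [e j] by [reflection_altword]. A vector is the sum of one
    in this plane and of one that both functionals kill, as the Gram determinant
    of the plane is the square of a nonzero sine. *)
Lemma rotation_order x : rot x = x.
Proof.
set c := form i (e j); set d := 1 - c ^+ 2.
have d0 : d != 0.
  rewrite /d /c cosE sqrrN cos2sin2 opprB addrCA subrr addr0 expf_neq0//.
  by rewrite gt_eqF ?sin_pi_div_gt0.
pose a := (form i x - c * form j x) / d.
pose b := (form j x - c * form i x) / d.
pose y := x - (a *: e i + b *: e j).
have xE : x = a *: e i + (b *: e j + y).
  by rewrite addrA addrC /y subrK.
have yi : form i y = 0.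
  rewrite /y -scaleN1r formD formZ formD !formZ form_diag -/c /a /b /d.
  by field.
have yj : form j y = 0.
  rewrite /y -scaleN1r formD formZ formD !formZ form_diag form_sym -/c /a /b /d.
  by field.
rewrite xE !rot_linear rot_l rot_r; congr (_ + (_ + _)).
by rewrite /rot; elim: {1}m => //= k ->; rewrite /= !reflection_fix.
Qed.

End FiniteOrder.
End Reflections.

(** * The geometric representation *)

Lemma linear_comb (K : nzRingType) (V : lmodType K) (f : {linear V -> V})
    (a b : K) x y : f (a *: x + b *: y) = a *: f x + b *: f y.
Proof. by rewrite linearP linearZ. Qed.

Section GeometricRep.
Variables (R : realType) (W : groupType) (S : set W).
Hypothesis hS : coxeter_system S.
Local Notation len := (coxeter_length S).
Local Notation E := (cox_space R S).
Local Notation e := (@simple_root R W S).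
Local Notation rho := (geometric_rep R S).
Local Notation P s t k := (word_prod (altword s t k)).
Implicit Types (s t : set_type S) (v w : W) (x y : E).

Let form s x := cox_form (e s) x.
Local Notation refl := (reflection e form).

Let formE s x : form s x = lin_ext (cox_coef R s) x.
Proof.
rewrite /form /cox_form /simple_root msuppU oner_eq0 big_seq_fset1.
by apply: eq_bigr => t _; rewrite mcoeffUU mul1r.
Qed.

Let form_root s t : form s (e t) = cox_coef R s t.
Proof. by rewrite formE lin_extU. Qed.

Let form_linear s a x y : form s (a *: x + y) = a * form s x + form s y.
Proof. by rewrite !formE lin_ext_linear. Qed.

Let form_sym s t : form s (e t) = form t (e s).
Proof.
rewrite !form_root /cox_coef; suff -> : group_order (val s * val t)%g =
  group_order (val t * val s)%g by [].
have sub (x : W) k : (x^-1 ^+ k == 1)%g = (x ^+ k == 1)%g.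
  by rewrite expVgn invg_eq1.
congr least; apply/funext => k; rewrite -sub.
by rewrite invgM !(gen_inv hS).
Qed.

Let form_diag s : form s (e s) = 1.
Proof.
rewrite form_root /cox_coef (gen_sqr hS).
have -> : group_order (1%g : W) = 1%N.
  have [|/andP[lt0 _] le1] :=
    @leastP (fun m => (0 < m)%N && ((1 : W) ^+ m == 1)%g).
    by exists 1%N; rewrite expg1 eqxx.
  by apply/eqP; rewrite eqn_leq lt0 andbT; apply: le1; rewrite expg1 eqxx.
by rewrite divr1 cospi opprK.
Qed.

(** The order of [s t] and the value of the form at [e_s] and [e_t], for
    distinct [s] and [t]. *)
Variant coef_spec s t : nat -> R -> Prop :=
| CoefFin m of (1 < m)%N : coef_spec s t m (- cos (pi / m%:R))
| CoefInf : coef_spec s t 0 (-1).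

Let coefP s t : s != t ->
  coef_spec s t (group_order (val s * val t)%g) (form s (e t)).
Proof.
move=> st; rewrite form_root /cox_coef.
have := expg_group_order (val s * val t)%g.
case: (group_order _) => [_|[|m] ord].
- by constructor.
- case/eqP: st; apply: val_inj; move: ord; rewrite expg1 => ord.
  by rewrite -(mulg_genK hS (val s) t) ord mul1g.
- by constructor.
Qed.

Let cheb_form_ge0 s t k : s != t ->
  (0 < group_order (val s * val t)%g -> k <= group_order (val s * val t)%g)%N ->
  0 <= cheb (- 2 * form s (e t)) k.
Proof.
move=> /coefP[m m1 km|_]; last by rewrite mulrNN mulr1 cheb_nat.
by rewrite mulrNN; apply: cheb_pi_div_ge0 => //; apply: km; lia.
Qed.

(** The reflection in a simple root, as a linear automorphism. *)
Definition refl_aut s : linear_aut E :=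
  LinearAut (reflection_linear e form_linear s)
    (reflectionK form_linear form_diag s) (reflectionK form_linear form_diag s).

Lemma geometric_repP : is_geometric_rep rho.
Proof.
suff [r rP] : exists r : W -> {linear E -> E}, is_geometric_rep r.
  exact: (xgetPex _ (ex_intro _ r rP)).
have [_ _ univ] := hS.
have [s t|phi phiP] := univ (linear_aut E) refl_aut.
  apply: linear_autP => x; rewrite aut_funX; have [<-|st] := eqVneq s t.
    rewrite -[RHS](iter_fix (group_order (val s * val s)%g) (erefl x)).
    by apply: eq_iter => y /=; rewrite (reflectionK form_linear form_diag).
  have := rotation_order form_linear form_diag form_sym (i := s) (j := t).
  case: (coefP st) => [m m1 /(_ m m1 erefl x)|]//.
have phi1 : (phi 1 = 1)%g.
  by apply: (mulgI (phi 1%g)); rewrite -gmulfM !mulg1.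
pose r w : E -> E := aut_fun (phi w).
have r_lin w : linear (r w) by exact: aut_linear.
pose rl w : {linear E -> E} :=
  HB.pack (r w) (GRing.isLinear.Build R E E *:%R (r w) (r_lin w)).
exists rl; split=> [x|v w x|s x].
- by rewrite /= /r phi1.
- by rewrite /= /r gmulfM.
- by rewrite /= /r phiP.
Qed.

Lemma rho1 x : rho 1%g x = x.
Proof. by have [] := geometric_repP. Qed.

Lemma rhoM v w x : rho (v * w)%g x = rho v (rho w x).
Proof. by have [] := geometric_repP. Qed.

Lemma rho_genE s x : rho (val s) x = refl s x.
Proof. by have [] := geometric_repP. Qed.

Lemma rhoK w : cancel (rho w) (rho w^-1%g).
Proof. by move=> x; rewrite -rhoM mulVg rho1. Qed.

Lemma rho_word ws x : rho (word_prod ws) x = foldr refl x ws.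
Proof.
elim: ws => [|s ws IH]; first by rewrite /word_prod big_nil rho1.
by rewrite word_prod_cons rhoM IH rho_genE.
Qed.

Lemma rho_gen_root s : rho (val s) (e s) = - e s.
Proof. by rewrite rho_genE (reflection_diag form_diag). Qed.

Lemma rho_gen_coef s t x : t != s -> mcoeff t (rho (val s) x) = mcoeff t x.
Proof.
move=> ts; rewrite rho_genE /reflection mcoeffB mcoeffZ mcoeffU.
by rewrite eq_sym (negPf ts) mulr0 subr0.
Qed.

(** The nonnegative combinations of the simple roots. *)
Definition nonneg x := forall t, 0 <= mcoeff t x.

Lemma nonneg_comb x y (a b : R) : 0 <= a -> 0 <= b -> nonneg x -> nonneg y ->
  nonneg (a *: x + b *: y).
Proof.
move=> a0 b0 x0 y0 t; rewrite mcoeffD !mcoeffZ.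
by apply: addr_ge0; apply: mulr_ge0; [|exact: x0| |exact: y0].
Qed.

Lemma nonneg_root s : nonneg (e s).
Proof. by move=> t; rewrite mcoeffU; case: (s == t). Qed.

(** In a reduced product of some [v] and an alternating word, the first letters
    of the word may be moved to [v]. *)
Lemma altword_shorten w s t j k v : (j <= k)%N ->
  w = (v * P s t k)%g -> (len v + k <= len w)%N ->
  exists2 v', w = (v' * P s t j)%g & (len v' + j <= len w)%N.
Proof.
elim: k v => [|k IH] v; first by rewrite leqn0 => /eqP ->; exists v.
rewrite leq_eqVlt => /orP[/eqP ->|jk]; first by exists v.
rewrite altprodS mulgA => wE lw; apply: (IH _ jk wE).
by rewrite (leq_trans _ lw)// -addSnnS leq_add2r lenM_gen.
Qed.

(** A root [w e_s] is nonnegative unless [s] shortens [w]. With [t] a last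
    letter of [w], write [w] as a reduced product [v P] with [P] the longest
    possible alternating word in [s] and [t]; the length of [P] is less than
    the order of [s t], so that [P e_s] is a nonnegative combination of [e_s]
    and [e_t], and neither [s] nor [t] shortens [v]. *)
Lemma root_nonneg w s : (len w <= len (w * val s)%g)%N -> nonneg (rho w (e s)).
Proof.
have [n] := ubnP (len w); elim: n w s => // n IH w s; rewrite ltnS => lwn lws.
have [w0|w_gt0] := posnP (len w).
  by rewrite (len_eq0 hS w0) rho1; apply: nonneg_root.
have [t lwt] := last_letter hS w_gt0.
have st : s != t by apply: contraTneq lws => ->; lia.
pose Q k := `[< exists2 v, w = (v * P s t k)%g & (len v + k <= len w)%N >].
have Q1 : Q 1%N.
  apply/asboolP; exists (w * val t)%g; last by lia.
  by rewrite /word_prod big_seq1 mulg_genK.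
have Qub k : Q k -> (k <= len w)%N by move=> /asboolP[v _]; lia.
have exQ : exists k, Q k by exists 1%N.
case: (ex_maxnP exQ Qub) => k /asboolP[v wE lv] kmax.
have k_gt0 : (0 < k)%N by apply: kmax.
have alt_le u l : (len (u * P s t l)%g <= len u + l)%N.
  rewrite (leq_trans (lenM hS _ _))// leq_add2l.
  by rewrite -{2}(size_altword s t l) len_word.
(* otherwise the last letters of [P] could be replaced by the alternating word
   of the same product that ends in [s], and [s] would shorten [w] *)
have km : let m := group_order (val s * val t)%g in (0 < m -> k < m)%N.
  set m := group_order _ => /= m_gt0; rewrite ltnNge; apply/negP => mk.
  have [v' wE' lv'] := altword_shorten mk wE lv.
  move: lws; rewrite leqNgt => /negP; apply.
  have -> : (w * val s)%g = (v' * P s t m.-1)%g.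
    rewrite wE' /m altprod_order// -/m -{1}(prednK m_gt0).
    by rewrite altprodSr// mulgA mulg_genK.
  by have := alt_le v' m.-1; lia.
pose x := if odd k then s else t; pose y := if odd k then t else s.
(* [k] is maximal, and [w] has no shorter expression *)
have vx : (len v <= len (v * val x)%g)%N.
  rewrite leqNgt; apply/negP => lvx.
  suff /kmax : Q k.+1 by rewrite ltnn.
  apply/asboolP; exists (v * val x)%g; last by lia.
  by rewrite altprodS mulgA mulg_genK.
have vy : (len v <= len (v * val y)%g)%N.
  rewrite leqNgt; apply/negP => lvy.
  have wE' : w = (v * val y * P s t k.-1)%g.
    have -> : y = if odd k.-1 then s else t.
      by rewrite /y -{1}(prednK k_gt0) /=; case: odd.
    by rewrite wE -{1}(prednK k_gt0) altprodS mulgA.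
  by have := alt_le (v * val y)%g k.-1; rewrite -wE'; lia.
rewrite wE rhoM rho_word (reflection_altword form_linear form_diag form_sym).
rewrite linear_comb.
apply: nonneg_comb; [| |apply: IH => //; lia..].
- by apply: cheb_form_ge0 => // /km; lia.
- by apply: cheb_form_ge0 => // /km; lia.
Qed.

End GeometricRep.

(** * Half-spaces and chambers *)

Lemma linear_funP (K : nzRingType) (U : lmodType K) (V : zmodType)
  (s : K -> V -> V) (f g : {linear U -> V | s}) : f =1 g -> f = g.
Proof.
case: f g => [f cf] [g cg] /= /funext fg; subst g.
congr GRing.Linear.Pack; case: cf cg => [[fa] [fs]] [[ga] [gs]].
by congr GRing.Linear.Class; [congr Algebra.isNmodMorphism.Axioms_
                             | congr GRing.isScalable.Axioms_];
   exact: Prop_irrelevance.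
Qed.

(** A map into a space of functions is continuous for pointwise convergence if
    its evaluations are. *)
Lemma continuous_ptws (T : topologicalType) (U : choiceType)
    (V : topologicalType) (g : T -> {ptws U -> V}) :
  (forall x, continuous (fun t => g t x)) -> continuous g.
Proof.
move=> cg t; apply/cvg_sup => x; apply/cvg_image.
  by rewrite eqEsubset; split=> v // _; exists (cst v).
move=> A /cg; rewrite nbhs_simpl /= => At.
exists ((@^~ x) @^-1` A); first exact: At.
by rewrite eqEsubset; split=> [_ [h ? <-]//|v Av]; exists (cst v).
Qed.

Section Dual.
Variables (R : realType) (W : groupType) (S : set W).
Local Notation dual := (dual_space R S).
Local Notation E := (cox_space R S).
Implicit Types (f g : dual) (x : E).

Lemma dual_ext f g : pairing f =1 pairing g -> f = g.
Proof. exact: linear_funP. Qed.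

Lemma pairing_continuous x : continuous (fun f => pairing f x).
Proof.
pose F (f : dual) : {ptws E -> R} := (f : {linear E -> R^o}) : E -> R.
have cF : continuous F by exact: initial_continuous.
have cx : continuous (proj x : {ptws E -> R} -> R) by exact: proj_continuous.
by move=> f; apply: (@continuous_comp _ _ _ F (proj x)); [exact: cF|exact: cx].
Qed.

Lemma continuous_dual (T : topologicalType) (g : T -> dual) :
  (forall x, continuous (fun t => pairing (g t) x)) -> continuous g.
Proof.
by move=> cg; apply: continuous_comp_initial; apply: continuous_ptws.
Qed.

Let line_linear f g (t : R) :
  linear ((fun x => pairing f x + t * pairing g x) : E -> R^o).
Proof.
move=> a x y; rewrite /pairing !linearP /= mulrDr addrACA scalerDr.
by rewrite -[a *: (_ * _)]/(a * (_ * _)) mulrCA.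
Qed.

(** The line through [f] with direction [g]. *)
Definition dual_line f g (t : R) : dual :=
  HB.pack (fun x => pairing f x + t * pairing g x : R^o)
    (GRing.isLinear.Build R E R^o *:%R _ (line_linear f g t)).

Lemma pairing_line f g t x :
  pairing (dual_line f g t) x = pairing f x + t * pairing g x.
Proof. by []. Qed.

Lemma dual_line_continuous f g : continuous (dual_line f g).
Proof.
apply: continuous_dual => x t /=; apply: cvgD; first exact: cvg_cst.
by apply: cvgM; [exact: cvg_id | exact: cvg_cst].
Qed.


Lemma component_hyperplane x f : pairing f x != 0 ->
  connected_component (~` [set g : dual | pairing g x = 0]) f =
  [set g | 0 < pairing f x * pairing g x].
Proof.
move=> fx0; apply/seteqP; split=> g.
- set C := connected_component _ _ => Cg /=.
  have Cf : C f by apply: connected_component_refl; apply/eqP.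
  have /connected_intervalP Cint : connected ((fun h => pairing h x) @` C).
    apply: connected_continuous_connected; first exact: component_connected.
    by apply: continuous_subspaceT; exact: pairing_continuous.
  have C0 h : C h -> pairing h x <> 0 by move/connected_component_sub.
  have sep (a b : dual) :
      C a -> C b -> pairing a x < 0 -> 0 < pairing b x -> False.
    move=> Ca Cb a0 b0; have := Cint (pairing a x) (pairing b x).
    case/(_ _ _ 0 _)=> [||//|h Ch /(C0 _ Ch)//]; [by exists a|by exists b|].
    by rewrite !ltW.
  case: (ltgtP (pairing g x) 0) (C0 _ Cg) => // gx _;
    case: (ltgtP (pairing f x) 0) fx0 => // fx _.
  + by rewrite nmulr_rgt0.
  + by have := sep _ _ Cg Cf gx fx.
  + by have := sep _ _ Cf Cg fx gx.
  + by rewrite mulr_gt0.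
- move=> /= fg; pose p := dual_line f (dual_line g f (-1)).
  have pE t y : pairing (p t) y = pairing f y + t * (pairing g y - pairing f y).
    by rewrite !pairing_line mulN1r.
  have p0 : p 0 = f by apply: dual_ext => y; rewrite pE mul0r addr0.
  have p1 : p 1 = g by apply: dual_ext => y; rewrite pE mul1r addrC subrK.
  apply: (@connected_component_max _ _ (p @` `[0, 1])).
  + by exists 0; rewrite //= in_itv /= lexx ler01.
  + move=> _ [t /= + <-] px; rewrite in_itv /= => /andP[t0 t1].
    have : 0 < pairing f x * pairing (p t) x.
      have fx2 : 0 < pairing f x ^+ 2 by rewrite exprn_even_gt0.
      rewrite pE mulrDr mulrCA mulrBr -expr2.
      have [->|t0'] := eqVneq t 0; first by rewrite mul0r addr0.
      rewrite mulrBr addrCA -{1}[_ ^+ 2]mul1r -mulrBl ltr_wpDr//.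
        by rewrite mulr_ge0 ?subr_ge0// ltW.
      by rewrite mulr_gt0// lt_neqAle eq_sym t0'.
    by rewrite px mulr0 ltxx.
  + apply: connected_continuous_connected; first exact: segment_connected.
    by apply: continuous_subspaceT; exact: dual_line_continuous.
  + by exists 1; rewrite //= in_itv /= lexx ler01.
Qed.

Lemma closure_half_space x : (exists g : dual, 0 < pairing g x) ->
  closure [set f : dual | 0 < pairing f x] = [set f | 0 <= pairing f x].
Proof.
move=> [g gx]; apply/seteqP; split=> f.
  move=> cf /=; have cl : closed [set f : dual | 0 <= pairing f x].
    rewrite (_ : [set _ | _] = (fun f => pairing f x) @^-1` [set y | 0 <= y])//.
    apply: preimage_closed => [h _|]; first exact: pairing_continuous.
    exact: closed_ge.
  by apply: cl; apply: closureS cf => h /ltW.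
rewrite /= => fx B fB.
have : nbhs (0 : R) (dual_line f g @^-1` B).
  apply: dual_line_continuous; rewrite (_ : dual_line f g 0 = f)//.
  by apply: dual_ext => y; rewrite pairing_line mul0r addr0.
move=> /nbhs_ballP[d /= d0 dB]; exists (dual_line f g (d / 2)); split.
  change (0 < pairing (dual_line f g (d / 2)) x).
  by rewrite pairing_line ltr_wpDl// mulr_gt0// divr_gt0.
apply: (dB (d / 2)); rewrite /ball /= sub0r normrN ger0_norm ?divr_ge0 ?ltW//.
by rewrite ltr_pdivrMr// ltr_pMr// ltr1n.
Qed.

End Dual.

#[local] Arguments pairing : simpl never.
#[local] Arguments dual_act : simpl never.

Section HalfSpaces.
Variables (R : realType) (W : groupType) (S : set W).
Hypothesis hS : coxeter_system S.
Local Notation len := (coxeter_length S).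
Local Notation dual := (dual_space R S).
Local Notation E := (cox_space R S).
Local Notation e := (@simple_root R W S).
Local Notation rho := (geometric_rep R S).
Implicit Types (s t : set_type S) (u v w : W) (f g : dual) (D : set dual).

Let pairing_dual_act w f (x : E) :
  pairing (dual_act w f) x = pairing f (rho w^-1%g x).
Proof. by []. Qed.

Lemma pairingN f (x : E) : pairing f (- x) = - pairing f x.
Proof. exact: raddfN. Qed.

Lemma pairingZ f a (x : E) : pairing f (a *: x) = a * pairing f x.
Proof. exact: linearZ. Qed.

Lemma dual_actK w : cancel (@dual_act R W S w) (dual_act w^-1%g).
Proof.
by move=> f; apply: dual_ext => x; rewrite !pairing_dual_act invgK rhoK.
Qed.

Lemma dual_actVK w : cancel (@dual_act R W S w^-1%g) (dual_act w).
Proof. by move=> f; rewrite -{1}(invgK w) dual_actK. Qed.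

Lemma dual_act_image w D : dual_act w @` D = dual_act w^-1%g @^-1` D.
Proof.
apply/seteqP; split=> [_ [f Df <-]|f Df] /=; first by rewrite dual_actK.
by exists (dual_act w^-1%g f) => //; rewrite dual_actVK.
Qed.

(** The functional with value [1] at all the simple roots. *)
Definition height : dual :=
  HB.pack (lin_ext (fun=> 1) : E -> R^o)
    (GRing.isLinear.Build R E R^o *:%R _ (lin_ext_linear (fun=> 1))).

Lemma height_root s : pairing height (e s) = 1.
Proof. exact: lin_extU. Qed.

Lemma pairing_sum f (x : E) :
  pairing f x = \sum_(t <- msupp x) mcoeff t x * pairing f (e t).
Proof.
transitivity (pairing f (\sum_(t <- msupp x) mcoeff t x *: e t)).
  congr pairing; rewrite {1}[x]monalgE; apply: eq_bigr => t _.
  apply/malgP => k; rewrite mcoeffZ /simple_root !mcoeffU; case: (t == k).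
    by rewrite mulr1n mulr1.
  by rewrite mulr0n mulr0.
by rewrite /pairing linear_sum /=; apply: eq_bigr => t _; rewrite linearZ.
Qed.

(** The fundamental chamber. *)
Definition dominant f := forall s, 0 < pairing f (e s).

Lemma height_dominant : dominant height.
Proof. by move=> s; rewrite height_root. Qed.

Lemma dominant_ge0 f (x : E) : dominant f -> nonneg x -> 0 <= pairing f x.
Proof.
move=> fd x0; rewrite pairing_sum; apply: sumr_ge0 => t _.
by rewrite mulr_ge0// ltW.
Qed.

Lemma dominant_gt0 f (x : E) : dominant f -> nonneg x -> x != 0 ->
  0 < pairing f x.
Proof.
move=> fd x0 xn0; rewrite lt_neqAle dominant_ge0// andbT eq_sym.
apply: contra xn0; rewrite pairing_sum psumr_eq0; last first.
  by move=> t _; rewrite mulr_ge0// ltW.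
move=> /allP x00; apply/eqP/malgP => t; rewrite mcoeff0.
case: msuppP => // tx; have /= := x00 t tx.
by rewrite mulf_eq0 (gt_eqF (fd t)) orbF => /eqP.
Qed.

Lemma root_neq0 u s : rho u (e s) != 0.
Proof.
apply: contraTneq (ltr01 : 0 < 1 :> R) => /(congr1 (rho u^-1%g)).
rewrite rhoK// linear0 => /(congr1 (pairing height)).
by rewrite height_root /pairing linear0 => ->; rewrite ltxx.
Qed.

Lemma rho_flip u s : rho (u * val s)%g (e s) = - rho u (e s).
Proof. by rewrite rhoM// rho_gen_root// linearN. Qed.

Lemma root_pos f u s : dominant f ->
  (len u <= len (u * val s)%g)%N -> 0 < pairing f (rho u (e s)).
Proof.
move=> fd le; apply: dominant_gt0 => //; first exact: root_nonneg.
exact: root_neq0.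
Qed.

Lemma root_neg f u s : dominant f ->
  (len (u * val s)%g <= len u)%N -> pairing f (rho u (e s)) < 0.
Proof.
move=> fd le; rewrite -oppr_gt0 -pairingN -rho_flip; apply: root_pos => //.
by rewrite mulg_genK.
Qed.

Lemma lenM_gen_neq u s : len (u * val s)%g != len u.
Proof.
apply/eqP => le; have := @root_pos _ u s height_dominant.
have := @root_neg _ u s height_dominant.
by rewrite le leqnn => /(_ isT) lt0 /(_ isT); rewrite ltNge (ltW lt0).
Qed.

(** The half-space of the functionals positive at the root [u e_s]. It
    contains the chamber of [u], and its wall is the one between this chamber
    and that of [u s]. *)
Definition root_half u s : set dual := [set f | 0 < pairing f (rho u (e s))].

Lemma dual_act_root_half w u s :
  dual_act w @` root_half u s = root_half (w * u) s.
Proof.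
rewrite dual_act_image; apply/seteqP; split=> f;
by rewrite /root_half /= pairing_dual_act invgK rhoM.
Qed.

Lemma opposite_root_half u s :
  opposite (root_half u s) = root_half (u * val s) s.
Proof.
rewrite /opposite closure_half_space; last first.
  exists (dual_act u height).

  by rewrite pairing_dual_act rhoK// height_root.
apply/seteqP; split=> f; rewrite /root_half /= rho_flip pairingN oppr_gt0.
  by move/negP; rewrite -ltNge.
by rewrite ltNge => /negP.
Qed.

Lemma half_spacesP D : half_spaces D <-> exists u s, D = root_half u s.
Proof.
have wallE u s : dual_act u @` simple_wall s =
    [set f : dual | pairing f (rho u (e s)) = 0].
  rewrite dual_act_image; apply/seteqP; split=> f;
  by rewrite /simple_wall /= pairing_dual_act invgK.
split=> [[_ [u [s ->]] [f]]|[u [s ->]]].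
  rewrite wallE /= => /eqP f0 ->; rewrite component_hyperplane//.
  have [fgt|flt|/eqP f0'] := ltgtP 0 (pairing f (rho u (e s))).
  - exists u, s; apply/seteqP; split=> g; rewrite /root_half /=;
    by rewrite pmulr_rgt0.
  - exists (u * val s)%g, s; apply/seteqP; split=> g; rewrite /root_half /=;
    by rewrite nmulr_rgt0// rho_flip pairingN oppr_gt0.
  - by rewrite eq_sym (negPf f0) in f0'.
have hE : pairing (dual_act u height) (rho u (e s)) = 1.
  by rewrite pairing_dual_act rhoK// height_root.
exists (dual_act u @` simple_wall s); first by exists u, s.
rewrite wallE; exists (dual_act u height) => /=.
  by rewrite hE; apply/eqP; rewrite oner_eq0.
by rewrite component_hyperplane hE ?oner_eq0//; apply/seteqP; split=> g;
  rewrite /root_half /= mul1r.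
Qed.

Lemma half_space_root u s : half_spaces (root_half u s).
Proof. by apply/half_spacesP; exists u, s. Qed.

Lemma half_space_opposite D : half_spaces D -> half_spaces (opposite D).
Proof.
case/half_spacesP => u [s ->]; rewrite opposite_root_half.
exact: half_space_root.
Qed.

Lemma oppositeK D : half_spaces D -> opposite (opposite D) = D.
Proof.
by case/half_spacesP => u [s ->]; rewrite !opposite_root_half mulg_genK.
Qed.

Lemma half_space_act v D : half_spaces D -> half_spaces (dual_act v @` D).
Proof.
case/half_spacesP => u [s ->]; rewrite dual_act_root_half.
exact: half_space_root.
Qed.

Lemma opposite_act v D : half_spaces D ->
  opposite (dual_act v @` D) = dual_act v @` opposite D.
Proof.
case/half_spacesP => u [s ->].
by rewrite dual_act_root_half !opposite_root_half dual_act_root_half mulgA.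
Qed.

(** Whether the chamber of [w] lies in [D]. *)
Definition contains D w : bool := `[< chamber w `<=` D >].

Lemma contains_dual_act v D w :
  contains (dual_act v @` D) (v * w) = contains D w.
Proof.
have chM : chamber (v * w) = dual_act v @` (chamber w : set dual).
  rewrite /chamber !dual_act_image; apply/seteqP; split=> f /=;
  by move=> + s => /(_ s); rewrite !pairing_dual_act !invgK rhoM.
by rewrite /contains chM; congr asbool; apply/propext; rewrite !dual_act_image;
  split=> sub f => [|/sub]; rewrite /= ?dual_actK//;
  move=> cf; have := sub (dual_act v f); rewrite /= dual_actK; apply.
Qed.

Let chamberP w f : chamber w f -> dominant (dual_act w^-1%g f).
Proof. by rewrite /chamber dual_act_image. Qed.

(** The chamber of [w] lies in the half-space of [u e_s] if and only if it is
    closer to that of [u] than to that of [u s]. *)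
Lemma contains_root_half u s w :
  contains (root_half u s) w = (len (w^-1 * u)%g < len (w^-1 * u * val s)%g)%N.
Proof.
have pE f : pairing f (rho u (e s)) =
    pairing (dual_act w^-1%g f) (rho (w^-1 * u)%g (e s)).
  by rewrite pairing_dual_act invgK -rhoM// mulgA mulgV mul1g.
apply/asboolP/idP => [sub|lt].
  have /sub : chamber w (dual_act w height).
    by rewrite /chamber dual_act_image /= dual_actK; exact: height_dominant.
  rewrite /root_half /= pE dual_actK ltnNge => h; apply/negP => le.
  by move: h; rewrite ltNge ltW// root_neg//; exact: height_dominant.
move=> f /chamberP fd; rewrite /root_half /= pE.
by apply: root_pos => //; exact: ltnW.
Qed.

Lemma contains_root_halfN u s w :
  ~~ contains (root_half u s) w =
  (len (w^-1 * u * val s)%g < len (w^-1 * u)%g)%N.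
Proof.
by rewrite contains_root_half -leqNgt leq_eqVlt (negPf (lenM_gen_neq _ _)).
Qed.

Lemma contains_opposite D w : half_spaces D ->
  contains (opposite D) w = ~~ contains D w.
Proof.
move=> /half_spacesP[u [s ->]]; rewrite opposite_root_half contains_root_half.
by rewrite contains_root_halfN mulgA mulg_genK.
Qed.

Lemma contains_root_half_id u s : contains (root_half u s) u.
Proof.
rewrite contains_root_half mulVg mul1g len1// lt0n.
by have := lenM_gen_neq 1%g s; rewrite mul1g len1.
Qed.

Lemma contains_root_halfN_id u s : ~~ contains (root_half u s) (u * val s)%g.
Proof.
rewrite -contains_opposite; last exact: half_space_root.
by rewrite opposite_root_half contains_root_half_id.
Qed.

(** The only wall between two adjacent chambers is their common one: a root
    that the reflection in [e_s] makes negative is a multiple of [e_s]. *)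
Lemma half_space_adjacent D u s : half_spaces D ->
  contains D u -> ~~ contains D (u * val s)%g -> D = root_half u s.
Proof.
move=> /half_spacesP[v [t ->]]; rewrite contains_root_half => lt.
rewrite contains_root_halfN invgM (gen_inv hS) -!mulgA => lt'.
set x := rho (u^-1 * v)%g (e t).
have x0 : nonneg x by apply: root_nonneg => //; apply: ltnW.
have sx0 : nonneg (- rho (val s) x).
  rewrite /x -rhoM// -rho_flip; apply: root_nonneg => //.
  by rewrite mulg_genK// -!mulgA ltnW.
have xE : x = mcoeff s x *: e s.
  apply/malgP => k; rewrite mcoeffZ mcoeffU; have [<-|sk] := eqVneq s k.
    by rewrite mulr1.
  rewrite mulr0; apply/eqP; rewrite eq_le x0 andbT -oppr_ge0.
  by have := sx0 k; rewrite mcoeffN rho_gen_coef// eq_sym.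
have xs : 0 < mcoeff s x.
  rewrite lt_neqAle x0 andbT eq_sym; apply/eqP => xs0.
  by have := root_neq0 (u^-1 * v) t; rewrite -/x xE xs0 scale0r eqxx.
have vE : rho v (e t) = mcoeff s x *: rho u (e s).
  by rewrite -linearZ -xE /x -rhoM// mulgA mulgV mul1g.
by apply/seteqP; split=> f; rewrite /root_half /= vE pairingZ pmulr_rgt0.
Qed.

End HalfSpaces.

(** * Collapsing cocycles *)

Section Homogeneous.
Variables (W : groupType) (S : set W).
Hypothesis hS : coxeter_system S.
Variables (A : zmodType) (act : W -> A -> A).
Hypothesis hact : group_module act.
Variables (n : nat) (zeta : n.-tuple W -> A).
Hypotheses (hzeta : cocycle act zeta) (hcol : collapsing S zeta).
Local Notation len := (coxeter_length S).
Implicit Types (g : nat -> W) (p q u v w x y : W) (s t : set_type S).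

Lemma act1 a : act 1%g a = a. Proof. by case: hact. Qed.
Lemma actM x y a : act (x * y)%g a = act x (act y a). Proof. by case: hact. Qed.
Lemma actD x a b : act x (a + b) = act x a + act x b. Proof. by case: hact. Qed.
Lemma act0 x : act x 0 = 0.
Proof. by apply: (addrI (act x 0)); rewrite -actD !addr0. Qed.
Lemma actN x a : act x (- a) = - act x a.
Proof. by apply: (addrI (act x a)); rewrite -actD !subrr act0. Qed.
Lemma act_sum (I : Type) (r : seq I) (P : pred I) (F : I -> A) x :
  act x (\sum_(i <- r | P i) F i) = \sum_(i <- r | P i) act x (F i).
Proof. exact: (big_morph (act x) (actD x) (act0 x)). Qed.
Lemma actMz x a (k : int) : act x (a *~ k) = act x a *~ k.
Proof.
have nat m : act x (a *+ m) = act x a *+ m.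
  by elim: m => [|m IH]; rewrite ?mulr0n ?act0// !mulrS actD IH.
by case: k => m; rewrite ?NegzE ?mulrNz ?actN -!pmulrn nat.
Qed.

(** The word metric. *)
Definition dist x y := len (x^-1 * y)%g.

Lemma distxx x : dist x x = 0%N.
Proof. by rewrite /dist mulVg len1. Qed.
Lemma distC x y : dist x y = dist y x.
Proof. by rewrite /dist -(lenV hS) invgM invgK. Qed.

(** The homogeneous cochain of [zeta]; only [g 0], ..., [g n] matter. *)
Definition homog g : A :=
  act (g 0%N) (zeta [tuple ((g i)^-1 * g i.+1)%g | i < n]).

Lemma eq_homog g g' :
  (forall i, (i <= n)%N -> g i = g' i) -> homog g = homog g'.
Proof.
move=> gg'; rewrite /homog gg'//; congr (act _ (zeta _)).
by apply: eq_from_tnth => i; rewrite !tnth_mktuple !gg'// ltnW.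
Qed.

Lemma act_homog w g : act w (homog g) = homog (fun i => w * g i)%g.
Proof.
rewrite /homog -actM; congr (act _ (zeta _)).
by apply: eq_from_tnth => i; rewrite !tnth_mktuple invgM -mulgA mulKg.
Qed.

Lemma homog_cocycle g :
  \sum_(j < n.+2) homog (fun i => g (bump j i)) *~ (-1) ^+ j = 0.
Proof.
pose x := [tuple ((g i)^-1 * g i.+1)%g | i < n.+1].
transitivity (act (g 0%N) (coboundary act zeta x)); last by rewrite hzeta act0.
rewrite /coboundary !actD act_sum big_ord_recl big_ord_recr /=.
rewrite expr0 mulr1z -addrA.
congr (_ + (_ + _)).
- rewrite -actM /homog /thead tnth_mktuple /= mulVKg /bump /= add1n.
  by congr (act _ (zeta _)); apply: eq_from_tnth => i; rewrite !tnth_mktuple.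
- apply: eq_bigr => j _; rewrite actMz /homog /=; congr (act _ (zeta _) *~ _).
  apply: eq_from_tnth => i; rewrite !tnth_mktuple /= /bump /= !add1n !ltnS.
  case: (ltngtP i j) => [ij|ji|/val_inj ->].
  + by rewrite !add0n.
  + rewrite (negPf (_ : i != j)) ?add1n//.
    by apply: contraTneq ji => ->; rewrite ltnn.
  + by rewrite eqxx -mulgA mulVKg.
- rewrite actMz /homog /= /bump /= add1n; congr (act _ (zeta _) *~ _).
  apply: eq_from_tnth => i; rewrite !tnth_mktuple /= /bump.
  have lt := ltn_ord i.
  by rewrite ltnS (leqNgt n i) lt (ltnNge n i) (ltnW lt) !add0n.
Qed.

Lemma homog_collapse g i : (i.+1 < n)%N ->
  dist (g i) (g i.+2) = (dist (g i) (g i.+1) + dist (g i.+1) (g i.+2))%N ->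
  homog g = 0.
Proof.
move=> i1n; have i_n : (i < n)%N by apply: ltnW.
move=> di; rewrite /homog (hcol (i := Ordinal i_n) (j := Ordinal i1n)) ?act0//.
by rewrite !tnth_mktuple /= -di /dist -mulgA mulVKg.
Qed.

(** Inserting a point on a geodesic from a vertex of a simplex to the next one
    splits the value of the cocycle in two. *)
Lemma homog_insert g i : (i <= n.-1)%N -> (0 < n)%N ->
  dist (g i) (g i.+2) = (dist (g i) (g i.+1) + dist (g i.+1) (g i.+2))%N ->
  homog (fun k => g (bump i.+1 k)) =
  homog (fun k => g (bump i k)) + homog (fun k => g (bump i.+2 k)).
Proof.
move=> i_n n0 di; have := homog_cocycle g.
have o0 : (i < n.+2)%N by lia.
have o1 : (i.+1 < n.+2)%N by lia.
have o2 : (i.+2 < n.+2)%N by lia.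
rewrite (bigD1 (Ordinal o0))//= (bigD1 (Ordinal o1))/=; last first.
  by rewrite -val_eqE /=; lia.
rewrite (bigD1 (Ordinal o2))/=; last by rewrite -!val_eqE /=; lia.
rewrite big1 ?addr0 => [|j].
  have sgn (a b c : A) (m : nat) : a *~ (-1) ^+ m + (b *~ (-1) ^+ m.+1 +
      c *~ (-1) ^+ m.+2) = 0 -> b = a + c.
    rewrite !exprS !mulN1r opprK mulrNz -signr_odd; case: (odd m).
      rewrite expr1 !mulrN1z opprK addrCA -opprD => /eqP.
      by rewrite subr_eq0 => /eqP.
    rewrite expr0 !mulr1z addrCA addrC => /eqP.
    by rewrite subr_eq0 => /eqP <-.
  exact: sgn.
rewrite -!val_eqE /= => jP.
suff -> : homog (fun k => g (bump j k)) = 0 by rewrite mul0rz.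
have [ji|ij] := ltnP j i.
  apply: (@homog_collapse _ i.-1); first by lia.
  have bE k : (i.-1 <= k)%N -> bump j k = k.+1 by rewrite /bump => ik; lia.
  by rewrite !bE ?(ltn_predK ji)//; lia.
apply: (@homog_collapse _ i); first by have := ltn_ord j; lia.
have bE k : (k <= i.+2)%N -> bump j k = k by rewrite /bump => ik; lia.
by rewrite !bE ?leqnn ?leqnSn ?leqW.
Qed.

End Homogeneous.

Section Galleries.
Variables (R : realType) (W : groupType) (S : set W).
Hypothesis hS : coxeter_system S.
Local Notation len := (coxeter_length S).
Local Notation dist := (dist S).
Local Notation half := (@root_half R W S).
Local Notation H := (@half_spaces R W S).
Implicit Types (p q u v w x y : W) (s t : set_type S) (ws : seq (set_type S)).
Implicit Types (D : set (dual_space R S)).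

(** A word of minimal length among those with the same product. *)
Definition reduced ws := len (word_prod ws) == size ws.

Lemma reduced_cat ws ws' : reduced (ws ++ ws') -> reduced ws /\ reduced ws'.
Proof.
rewrite /reduced word_prod_cat size_cat => /eqP e.
have := lenM hS (word_prod ws) (word_prod ws').
have := len_word hS ws; have := len_word hS ws'.
by move=> *; split; apply/eqP; lia.
Qed.

Lemma reduced_wordP u v : exists2 ws, reduced ws & v = (u * word_prod ws)%g.
Proof.
have [ws sz wsE] := reduced_word hS (u^-1 * v)%g.
by exists ws; rewrite /reduced wsE ?sz// mulVKg.
Qed.

Lemma dist_word u ws : reduced ws -> dist u (u * word_prod ws) = size ws.
Proof. by rewrite /dist mulKg => /eqP. Qed.

(** The half-space of an edge contains the vertices closer to its origin; the
    distances to both ends differ by one. *)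
Lemma dist_edge p s w : contains (half p s) w ->
  dist (p * val s) w = (dist p w).+1.
Proof.
rewrite contains_root_half// => lt.
rewrite (distC hS p) (distC hS (p * val s)%g) /dist mulgA.
by apply/eqP; rewrite eqn_leq lt lenM_gen.
Qed.

Lemma dist_edgeN p s w : ~~ contains (half p s) w ->
  dist p w = (dist (p * val s) w).+1.
Proof.
rewrite contains_root_halfN// => lt.
rewrite (distC hS p) (distC hS (p * val s)%g) /dist mulgA.
by apply/eqP; rewrite eqn_leq lt lenM_genV.
Qed.

Lemma distS p s : dist p (p * val s) = 1%N.
Proof.
by rewrite (distC hS) (dist_edge (contains_root_half_id R hS p s)) distxx.
Qed.

Lemma containsE p s w :
  contains (half p s) w = (dist p w < dist (p * val s) w)%N.
Proof. by rewrite contains_root_half// ![dist _ w](distC hS) /dist mulgA. Qed.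

(** The edges [(p, s)], from [p] to [p s], of the gallery of a word. *)
Fixpoint edges u ws : seq (W * set_type S) :=
  if ws is s :: ws' then (u, s) :: edges (u * val s) ws' else [::].

(** The half-spaces that a gallery leaves. *)
Definition left_halves u ws : seq (set (dual_space R S)) :=
  [seq half e.1 e.2 | e <- edges u ws].

Lemma edges_rcons u ws s :
  edges u (rcons ws s) = rcons (edges u ws) (u * word_prod ws, s)%g.
Proof.
elim: ws u => [|t ws IH] u; first by rewrite /word_prod big_nil mulg1.
by rewrite /= IH word_prod_cons mulgA.
Qed.

Lemma reduced_cons s ws : reduced (s :: ws) -> reduced ws.
Proof. by rewrite -cat1s => /reduced_cat[]. Qed.

(** The half-spaces that a geodesic leaves are those that contain its origin
    and not its end. *)
Lemma left_halvesP u ws D : reduced ws ->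
  D \in left_halves u ws = `[< [/\ H D, contains D u &
                               ~~ contains D (u * word_prod ws)%g ] >].
Proof.
elim: ws u => [|s ws IH] u red.
  rewrite /word_prod big_nil mulg1; apply/esym/asboolP => -[_ ->].
  by [].
have red' := reduced_cons red.
have dw : dist u (u * word_prod (s :: ws)) = (size ws).+1 by rewrite dist_word.
have := dist_word (u * val s) red'; rewrite -mulgA -word_prod_cons => dw'.
rewrite inE IH// -mulgA -word_prod_cons.
have Hus : ~~ contains (half u s) (u * word_prod (s :: ws))%g.
  by rewrite containsE -leqNgt dw dw'.
apply/idP/asboolP => [/orP[/eqP ->|/asboolP[HD cD ncD]]|[HD cD ncD]].
- split=> //; first exact: half_space_root.
  exact: contains_root_half_id.
- split=> //; apply: contraT => ncDu.
  (* otherwise [D] would be opposite to [half u s], so that it contains the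
     end of the gallery *)
  have /(congr1 (@opposite R W S)) : opposite D = half u s.
    apply: half_space_adjacent; rewrite ?contains_opposite ?cD//.
    exact: half_space_opposite.
  rewrite oppositeK// => DE; case/negP: ncD.
  by rewrite DE contains_opposite//; exact: half_space_root.
- have [cDs|ncDs] := boolP (contains D (u * val s)%g).
    by apply/orP; right; apply/asboolP.
  by apply/orP; left; apply/eqP; exact: half_space_adjacent.
Qed.

Lemma left_halves_uniq u ws : reduced ws -> uniq (left_halves u ws).
Proof.
elim: ws u => //= s ws IH u red.
have red' := reduced_cons red; rewrite IH// andbT left_halvesP//.
by apply/asboolP => -[_]; rewrite (negPf (contains_root_halfN_id R hS u s)).
Qed.

End Galleries.

Section WallFormula.
Variables (R : realType) (W : groupType) (S : set W).
Hypothesis hS : coxeter_system S.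
Variables (A : zmodType) (act : W -> A -> A).
Hypothesis hact : group_module act.
Variables (n : nat) (zeta : n.-tuple W -> A).
Hypotheses (n_gt1 : (1 < n)%N).
Hypotheses (hzeta : cocycle act zeta) (hcol : collapsing S zeta).
Local Notation dist := (dist S).
Local Notation half := (@root_half R W S).
Local Notation H := (@half_spaces R W S).
Local Notation homog := (homog act zeta).
Implicit Types (p q u v w : W) (s t : set_type S) (ws : seq (set_type S)).
Implicit Types (g : nat -> W) (D : set (dual_space R S)).

Lemma homog_degenerate g i : (i < n)%N -> g i = g i.+1 -> homog g = 0.
Proof.
move=> i_n gi; have [i1|ni] := ltnP i.+1 n.
  by apply: (homog_collapse hact hcol i1); rewrite gi (distxx hS).
case: i i_n gi ni => [|i] i_n gi ni; first by lia.
by apply: (homog_collapse hact hcol i_n); rewrite -gi (distxx hS) addn0.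
Qed.

(** The vertices [g k], ..., [g n] are alternately inside and outside [D], the
    even ones inside. *)
Definition alternates D g k :=
  all (fun i => contains D (g i) == ~~ odd i) (iota k (n.+1 - k)).

Lemma alternatesE D g k : (k <= n)%N -> alternates D g k =
  (contains D (g k) == ~~ odd k) && alternates D g k.+1.
Proof. by move=> kn; rewrite /alternates subSn// subSS. Qed.

Lemma eq_alternates D g g' k : (forall i, (k <= i)%N -> g i = g' i) ->
  alternates D g k = alternates D g' k.
Proof.
by move=> gg'; apply: eq_in_all => i; rewrite mem_iota => /andP[/gg' ->].
Qed.

(** The simplex obtained from [g] on replacing the first [k] vertices by
    [p], [q], [p], [q], ... *)
Definition zigzag p q k g i :=
  if (i < k)%N then if odd i then q else p else g i.

(** The value of the cocycle on the simplex [p], [p s], [p], [p s], ... *)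
Definition edge_val p s := homog (fun i => if odd i then (p * val s)%g else p).

Lemma homog_zigzagS p s k g : (1 < k <= n)%N ->
  homog (zigzag p (p * val s)%g k g) =
  if contains (half p s) (g k) == ~~ odd k
  then homog (zigzag p (p * val s)%g k.+1 g) else 0.
Proof.
case: k => [|[|m]]// /andP[_ mn]; set q := (p * val s)%g; set D := half p s.
pose z i := if odd i then q else p.
have dz i : dist (z i) (z i.+1) = 1%N.
  by rewrite /z /=; case: odd; rewrite /= ?distS// (distC hS) distS.
case: ifPn => side.
  have dg : dist (z m.+1) (g m.+2) = (dist (z m.+2) (g m.+2)).+1.
    move: side; rewrite /z /= negbK; case: odd => /=; rewrite ?eqbF_neg ?eqb_id.
    - exact: dist_edgeN.
    - exact: dist_edge.
  (* insert [z m.+2 = z m] between [z m.+1] and [g m.+2]: on replacing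
     [z m.+1], it gives a simplex with a repeated vertex *)
  pose G i := if (i < m.+3)%N then z i else g i.-1.
  have Gz i : (i < m.+3)%N -> G i = z i by rewrite /G => ->.
  have Gg i : (m.+2 <= i)%N -> G i.+1 = g i.
    by move=> mi; rewrite /G ifN// -leqNgt.
  have bE j i : (j <= m.+3)%N ->
      G (bump j i) = if (i < j)%N then G i else G i.+1.
    by rewrite /bump; case: leqP.
  have G0 : G m = z m by apply: Gz; lia.
  have G1 : G m.+1 = z m.+1 by apply: Gz; lia.
  have G2 : G m.+2 = z m.+2 by apply: Gz; lia.
  have G3 : G m.+3 = g m.+2 by apply: Gg.
  clearbody G.
  have := homog_insert hact hzeta hcol (g := G) (i := m.+1).
  rewrite G1 G2 G3 dg dz addSn add0n.
  move=> /(_ _ _ erefl) ins.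
  rewrite -(@eq_homog _ _ act n zeta (fun i => G (bump m.+2 i))); last first.
    move=> i _; rewrite bE// /zigzag; case: ltnP => im; last exact: Gg.
    by rewrite Gz//; apply: leqW.
  rewrite ins; [|lia|lia].
  rewrite (homog_collapse hact hcol (g := fun i => G (bump m.+1 i)) (i := m)).
  - rewrite add0r; apply: eq_homog => i _; rewrite bE// /zigzag.
    by case: ltnP => im; [exact: Gz | rewrite Gg// ltnW].
  - lia.
  - have -> : bump m.+1 m = m by rewrite /bump; lia.
    have -> : bump m.+1 m.+1 = m.+2 by rewrite /bump; lia.
    have -> : bump m.+1 m.+2 = m.+3 by rewrite /bump; lia.
    by rewrite G0 G2 G3 /z /= negbK (distxx hS).
(* [z m.+1] lies on a geodesic from [z m] to [g m.+2] *)
have dg : dist (z m) (g m.+2) = (dist (z m.+1) (g m.+2)).+1.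
  move: side; rewrite /z /= negbK.
  case: odd => /=; rewrite ?eqbF_neg ?eqb_id ?negbK.
  - exact: dist_edge.
  - exact: dist_edgeN.
apply: (homog_collapse hact hcol (i := m)); first by lia.
by rewrite /zigzag leqnn ltnn ltnW// -/(z m) -/(z m.+1) dz dg.
Qed.

Lemma homog_zigzag p s k g : (1 < k <= n.+1)%N ->
  homog (zigzag p (p * val s)%g k g) =
  if alternates (half p s) g k then edge_val p s else 0.
Proof.
move=> /andP[k1]; move: {2}(_ - _)%N (erefl (n.+1 - k)%N) => d.
elim: d k k1 => [|d IH] k k1 dE kn.
  have -> : k = n.+1 by lia.
  rewrite /alternates subnn /=; apply: eq_homog => i lin.
  by rewrite /zigzag ltnS lin.
rewrite homog_zigzagS; last by lia.
rewrite [in RHS]alternatesE; last by lia.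
by case: eqP => //= _; rewrite IH//; lia.
Qed.

(** The value of the cocycle is a sum over the walls that separate the first
    two vertices and about which the later ones alternate. *)
Lemma homog_gallery g ws : reduced ws -> g 1%N = (g 0%N * word_prod ws)%g ->
  homog g = \sum_(e <- edges (g 0%N) ws)
    if alternates (half e.1 e.2) g 2 then edge_val e.1 e.2 else 0.
Proof.
elim: ws g => [|s ws IH] g red g1.
  rewrite big_nil; apply: (homog_collapse hact hcol (i := 0%N)) => //.
  by rewrite g1 /word_prod big_nil mulg1 distxx.
have red' := reduced_cons hS red.
pose h := (g 0%N * val s)%g.
have d01 : dist (g 0%N) (g 1%N) = (size ws).+1 by rewrite g1 dist_word.
have g1' : g 1%N = (h * word_prod ws)%g by rewrite g1 word_prod_cons mulgA.
have dh1 : dist h (g 1%N) = size ws by rewrite g1' dist_word.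
(* insert [h] between the first two vertices *)
pose G i := if i is i'.+1 then if i' is i''.+1 then g i' else h else g 0%N.
have := homog_insert hact hzeta hcol (g := G) (i := 0%N).
rewrite /= d01 dh1 (distS R hS) add1n => /(_ (leq0n _) (ltnW n_gt1) erefl) ins.
rewrite -(@eq_homog _ _ act n zeta (fun i => G (bump 1 i))); last by case.
rewrite ins big_cons /= addrC; congr (_ + _).
  rewrite -homog_zigzag; last by lia.
  by apply: eq_homog => -[|[|i]].
rewrite IH//=; apply: eq_bigr => e _.
by congr (if _ then _ else _); apply: eq_alternates => -[|i].
Qed.

(** The value at an edge depends only on the half-space that the edge leaves. *)
Lemma edge_val_wd p s u t : half p s = half u t -> edge_val p s = edge_val u t.
Proof.
move=> DE; pose q := (p * val s)%g; pose v := (u * val t)%g.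
have vD : ~~ contains (half p s) v by rewrite DE contains_root_halfN_id.
have qD : ~~ contains (half p s) q by exact: contains_root_halfN_id.
have uD : contains (half p s) u by rewrite DE; exact: contains_root_half_id.
have pD : contains (half p s) p by exact: contains_root_half_id.
have dpv : dist p v = (dist q v).+1 by exact: (dist_edgeN hS vD).
have dvp : dist v p = (dist u p).+1.
  by apply: (dist_edge (R := R) hS); rewrite -DE.
pose g i := if i is i'.+1 then if odd i then v else u else p.
have gD : alternates (half p s) g 2.
  apply/allP => -[|i]; rewrite mem_iota; [by []|move=> _].
  by rewrite /g; case: odd; rewrite ?(negPf vD) ?uD.
have gD' : alternates (half u t) g 2 by move: gD; rewrite DE.
(* the simplex [p], [v], [u], [v], ... seen along a gallery through [q], and
   along one through [u] *)
transitivity (homog g).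
  have [ws red vE] := reduced_wordP hS q v.
  rewrite (@homog_gallery g (s :: ws)); last 2 first.
  - apply/eqP; rewrite word_prod_cons /= -(dist_word q red) -vE -dpv /dist.
    by rewrite vE -mulgA mulKg.
  - by rewrite /= vE word_prod_cons mulgA.
  rewrite big_cons /= big1_seq ?addr0 => [|e /andP[_ ews]].
    by rewrite gD.
  case: ifP => [|//]; rewrite (alternatesE _ _ n_gt1) => /andP[/eqP cu _].
  have : half e.1 e.2 \in left_halves R q ws by apply: map_f.
  rewrite (left_halvesP hS _ _ red) -vE => /asboolP[He cq cv].
  have eE : half e.1 e.2 = half u t by exact: half_space_adjacent.
  by move: qD; rewrite DE -eE cq.
have [ws red uE] := reduced_wordP hS p u.
rewrite (@homog_gallery g (rcons ws t)); last 2 first.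
- apply/eqP; rewrite size_rcons -(dist_word p red) -uE (distC hS) -dvp.
  rewrite -cats1 word_prod_cat (distC hS) /dist /v uE /word_prod big_seq1.
  by rewrite -mulgA mulKg.
- by rewrite /= -cats1 word_prod_cat mulgA -uE /word_prod big_seq1.
rewrite edges_rcons -cats1 big_cat /= big_seq1 /= -uE.
rewrite big1_seq ?add0r => [|e /andP[_ ews]].
  by rewrite gD'.
case: ifP => [|//]; rewrite (alternatesE _ _ n_gt1) => /andP[/eqP cu _].
have : half e.1 e.2 \in left_halves R p ws by apply: map_f.
by rewrite (left_halvesP hS _ _ red) -uE => /asboolP[He cq]; rewrite cu.
Qed.

(** The value of the cocycle attached to a half-space, and [0] for any other
    set. *)
Definition half_val D : A :=
  if pselect (exists e, D = half e.1 e.2) is left ex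
  then edge_val (projT1 (cid ex)).1 (projT1 (cid ex)).2 else 0.

Lemma half_valE p s : half_val (half p s) = edge_val p s.
Proof.
rewrite /half_val; case: pselect => [ex|[]]; last by exists (p, s).
by case: (cid ex) => -[u t] /= /esym; exact: edge_val_wd.
Qed.

Lemma half_val_act w D : H D -> half_val (dual_act w @` D) = act w (half_val D).
Proof.
move=> /(half_spacesP hS)[p [s ->]]; rewrite dual_act_root_half// !half_valE.
rewrite /edge_val act_homog//; apply: eq_homog => i _.
by case: odd; rewrite ?mulgA.
Qed.

Lemma half_val_opposite D : H D ->
  half_val (opposite D) = half_val D *~ (-1) ^+ n.
Proof.
move=> /(half_spacesP hS)[p [s ->]]; rewrite opposite_root_half// !half_valE.
set q := (p * val s)%g.
pose z i := if odd i then q else p.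
have := homog_cocycle hact hzeta z.
rewrite big_ord_recl big_ord_recr /= big1 ?add0r => [|j _]; last first.
  rewrite (@homog_degenerate _ j) ?mul0rz//=.
  by rewrite /bump /= add1n ltnn ltnSn add0n add1n /z /= negbK.
rewrite expr0 mulr1z /bump /= add1n exprS mulN1r mulrNz => /eqP.
rewrite subr_eq0 => /eqP; congr (_ = _ *~ _); apply: eq_homog => i lin.
  by rewrite add1n /z /=; case: odd; rewrite //= /q mulg_genK.
by rewrite ltnNge lin.
Qed.

Lemma homog_half g ws : reduced ws -> g 1%N = (g 0%N * word_prod ws)%g ->
  homog g = \sum_(D <- left_halves R (g 0%N) ws)
    if alternates D g 2 then half_val D else 0.
Proof.
move=> red g1; rewrite (homog_gallery red g1) big_map.
by apply: eq_bigr => e _; rewrite half_valE.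
Qed.

End WallFormula.

(** * The modules of half-spaces *)

(** The additive map on [Z[K]] that takes the value [F k] at the basis element
    [k]. *)
Section FreeExt.
Variables (K : choiceType) (A : zmodType) (F : K -> A).
Implicit Types x y : malg K int.

Definition free_ext x : A := \sum_(k <- msupp x) F k *~ mcoeff k x.

Lemma free_extE x (X : seq K) : uniq X ->
  (forall k, F k != 0 -> k \in msupp x -> k \in X) ->
  free_ext x = \sum_(k <- X) F k *~ mcoeff k x.
Proof.
move=> uX sub; rewrite /free_ext.
have nz k : F k *~ mcoeff k x != 0 -> F k != 0 /\ k \in msupp x.
  move=> nz; split; first by apply: contraNneq nz => ->; rewrite mul0rz.
  by rewrite -mcoeff_neq0; apply: contraNneq nz => ->; rewrite mulr0z.
have nzE (r : seq K) : \sum_(k <- r) F k *~ mcoeff k x =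
    \sum_(k <- r | F k *~ mcoeff k x != 0) F k *~ mcoeff k x.
  rewrite (bigID (fun k => F k *~ mcoeff k x != 0)) /=.
  rewrite [X in _ + X]big1 ?addr0//.
  by move=> k; rewrite negbK => /eqP.
rewrite nzE [RHS]nzE -big_filter -[RHS]big_filter; apply/perm_big/uniq_perm.
- exact/filter_uniq/fset_uniq.
- exact: filter_uniq.
move=> k; rewrite !mem_filter; case: eqP => //= /eqP/nz[Fk xk].
by rewrite (sub k Fk xk) xk.
Qed.

Lemma free_extB : {morph free_ext : x y / x - y}.
Proof.
move=> x y; pose X := (msupp x `|` msupp y)%fset.
rewrite !(@free_extE _ X) ?fset_uniq//.
- by rewrite -sumrB; apply: eq_bigr => k _; rewrite mcoeffB mulrzBr.
- by move=> k _; apply/fsubsetP; rewrite fsubsetUr.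
- by move=> k _; apply/fsubsetP; rewrite fsubsetUl.
- by move=> k _; apply/fsubsetP; exact: msuppB_le.
Qed.

Lemma free_ext0 : free_ext 0 = 0.
Proof. by rewrite /free_ext msupp0 big_seq_fset0. Qed.

Lemma free_extD : {morph free_ext : x y / x + y}.
Proof.
move=> x y; rewrite -{1}[y]opprK free_extB -[- y]sub0r free_extB free_ext0.
by rewrite sub0r opprK.
Qed.

Lemma free_extU k c : free_ext (mkmalgU k c) = F k *~ c.
Proof.
rewrite (@free_extE _ [:: k]) ?big_seq1 ?mcoeffUU//.
by move=> k' _; rewrite msuppU; case: ifP => _; rewrite !inE.
Qed.

Lemma free_ext_sum (I : Type) (r : seq I) (f : I -> malg K int) :
  free_ext (\sum_(i <- r) f i) = \sum_(i <- r) free_ext (f i).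
Proof. exact: (big_morph _ free_extD free_ext0). Qed.

End FreeExt.

(** The coefficient of a half-space in the geometric cocycle; [b i] tells
    whether the half-space contains the [i]-th chamber. *)
Definition alt_prod (b : nat -> bool) n : int :=
  \prod_(i < n) ((b i : nat)%:Z - (b i.+1 : nat)%:Z).

Lemma alt_prodS b n : alt_prod b n.+1 =
  alt_prod b n * ((b n : nat)%:Z - (b n.+1 : nat)%:Z).
Proof. by rewrite /alt_prod big_ord_recr. Qed.

Lemma alt_prodN b n : alt_prod (fun i => ~~ b i) n = (-1) ^+ n * alt_prod b n.
Proof.
elim: n => [|n IH]; first by rewrite /alt_prod !big_ord0 mulr1.
rewrite !alt_prodS IH exprSr -!mulrA; congr (_ * _).
by case: (b n) (b n.+1) => -[] /=; ring.
Qed.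

Lemma alt_prodE (b : nat -> bool) n : b 0%N -> alt_prod b n =
  if all (fun i => b i == ~~ odd i) (iota 0 n.+1) then (-1) ^+ n./2 else 0.
Proof.
move=> b0; have bz (i : nat) (c d : bool) : c == ~~ odd i -> (-1) ^+ i./2 *
    ((c : nat)%:Z - (d : nat)%:Z) = if d == odd i then (-1) ^+ (i.+1)./2 else 0.
  move=> /eqP ->; rewrite -uphalfE uphalf_half.
  by case: odd d => -[] /=; rewrite ?add0n ?add1n ?exprS; ring.
elim: n => [|n IH]; first by rewrite /alt_prod big_ord0 /= b0.
have -> : iota 0 n.+2 = iota 0 n.+1 ++ [:: n.+1] by rewrite -[n.+2]addn1 iotaD.
rewrite alt_prodS IH all_cat all_seq1 [~~ odd n.+1]negbK; set L := iota 0 _.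
case: (boolP (all _ L)) => [al|_]; last by rewrite mul0r.
rewrite bz //; have /allP := al; apply; rewrite mem_iota; lia.
Qed.

Section SignedModule.
Variables (R : realType) (W : groupType) (S : set W).
Hypothesis hS : coxeter_system S.
Local Notation half := (@root_half R W S).
Local Notation H := (@half_spaces R W S).
Local Notation free := (free_sets R S).
Local Notation hset := (set (dual_space R S)).
Implicit Types (D : hset) (x y : free) (g : hset -> hset) (w : W).

Lemma free_map0 g : free_map g (0 : free) = 0.
Proof. by rewrite /free_map msupp0 big_seq_fset0. Qed.

Lemma free_mapN g x : free_map g (- x) = - free_map g x.
Proof. by rewrite -sub0r free_mapB free_map0 sub0r. Qed.

Lemma free_mapD g : {morph free_map g : x y / x + y}.
Proof. by move=> x y; rewrite -{1}[y]opprK free_mapB free_mapN opprK. Qed.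

Lemma free_map_sum (I : Type) (r : seq I) (P : pred I) (f : I -> free) g :
  free_map g (\sum_(i <- r | P i) f i) = \sum_(i <- r | P i) free_map g (f i).
Proof. exact: (big_morph _ (free_mapD g) (free_map0 g)). Qed.

Lemma free_mapU g D c : free_map g (mkmalgU D c : free) = mkmalgU (g D) c.
Proof.
rewrite (@free_mapE _ _ _ _ _ [fset D]%fset) ?msuppU_le// big_seq_fset1.
by rewrite mcoeffUU.
Qed.

(** An element supported by the half-spaces. *)
Definition half_supported x := forall D, D \in msupp x -> H D.

Lemma mcoeff_opposite x D : half_supported x -> H D ->
  mcoeff D (free_map (@opposite R W S) x) = mcoeff (opposite D) x.
Proof.
move=> xH HD; rewrite [in RHS](monalgE x) /free_map !raddf_sum /=.
apply: eq_big_seq => D' /xH HD'; rewrite !mcoeffU; congr (_ *+ nat_of_bool _).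
by apply/eqP/eqP => [<-|->]; rewrite oppositeK.
Qed.

Lemma mcoeff_opposite0 x D : half_supported x -> ~ H D ->
  mcoeff D (free_map (@opposite R W S) x) = 0.
Proof.
move=> xH HD; rewrite /free_map raddf_sum big1_seq//= => D' /xH HD'.
rewrite mcoeffU; case: eqP => // DE; case: HD; rewrite -DE.
exact: half_space_opposite.
Qed.

Lemma signedP n x : x \in @signed_pred R W S n <-> half_supported x /\
  forall D, H D -> mcoeff (opposite D) x = mcoeff D x * (-1) ^+ n.
Proof.
have sgnE D : mcoeff D (if odd n then - x else x) = mcoeff D x * (-1) ^+ n.
  by rewrite -signr_odd; case: (odd n); rewrite ?mcoeffN ?mulrN1 ?mulr1.
split=> [/asboolP[xH sx]|[xH sx]].
  by split=> // D HD; rewrite -sgnE -sx mcoeff_opposite.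
apply/asboolP; split=> //; apply/malgP => D; rewrite sgnE.
have [HD|HD] := pselect (H D); first by rewrite mcoeff_opposite// sx.
rewrite mcoeff_opposite0// mcoeff_outdom ?mul0r//.
by apply/negP => /xH.
Qed.

Lemma signed_opposite n x : x \in @signed_pred R W S n ->
  free_map (@opposite R W S) x = x *~ (-1) ^+ n.
Proof.
case/asboolP => _ ->; rewrite -signr_odd; case: (odd n).
  by rewrite expr1 mulrN1z.
by rewrite expr0 mulr1z.
Qed.

Lemma free_map_Mz g x (k : int) : free_map g (x *~ k) = free_map g x *~ k.
Proof.
have nat m : free_map g (x *+ m) = free_map g x *+ m.
  by elim: m => [|m IH]; rewrite ?mulr0n ?free_map0// !mulrS free_mapD IH.
by case: k => m; rewrite ?NegzE ?mulrNz ?free_mapN -!pmulrn nat.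
Qed.

Lemma signed_act n w x : x \in @signed_pred R W S n ->
  free_act w x \in @signed_pred R W S n.
Proof.
move=> sx; have [xH _] := (signedP n x).1 sx; apply/asboolP; split.
  move=> D /= ; rewrite -mcoeff_neq0 /free_act /free_map raddf_sum /= => nz.
  apply: contrapT => HD; case/eqP: nz.
  rewrite big1_seq// => D' /andP[_ /xH HD'].
  rewrite mcoeffU; case: eqP => // DE; case: HD; rewrite -DE.
  exact: half_space_act.
have -> : free_map (@opposite R W S) (free_act w x) =
    free_act w (free_map (@opposite R W S) x).
  have comp g g' : free_map g (free_map g' x) =
      \sum_(D <- msupp x) (mkmalgU (g (g' D)) (mcoeff D x) : free).
    rewrite [X in free_map g X]/free_map free_map_sum.
    by apply: eq_bigr => D _; rewrite free_mapU.
  rewrite /free_act !comp; apply: eq_big_seq => D /xH HD.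
  by rewrite opposite_act.
rewrite (signed_opposite sx) /free_act free_map_Mz -signr_odd.
by case: (odd n); rewrite ?expr1 ?expr0 ?mulrN1z ?mulr1z.
Qed.

Lemma mcoeff_geometric n (x : n.-tuple W) D : (0 < n)%N ->
  mcoeff D (geometric_cocycle R S x) =
  if `[< H D >]
  then alt_prod (fun i => contains D (\prod_(y <- take i x) y)%g) n else 0.
Proof.
move=> n_gt0; pose g i := (\prod_(y <- take i x) y)%g; rewrite -/(g _).
pose c D := alt_prod (fun i => contains D (g i)) n.
have cE : geometric_cocycle R S x = \sum_(D \in H) mkmalgU D (c D).
  apply: eq_fsbigr => D' _; congr mkmalgU; apply: eq_bigr => i _.
  by rewrite /side /contains; do 2 case: asboolP.
have [ws red g1] := reduced_wordP hS (g 0%N) (g 1%N).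
(* the half-spaces that separate the first two vertices *)
pose r := undup (left_halves R (g 0%N) ws ++
  [seq opposite D | D <- left_halves R (g 0%N) ws]).
have rP D' : H D' -> c D' != 0 -> D' \in r.
  move=> HD'; rewrite /c /alt_prod; case: (n) n_gt0 => // m _.
  rewrite big_ord_recl mulf_eq0 negb_or => /andP[c01 _].
  rewrite mem_undup mem_cat; have [c0|c0] := boolP (contains D' (g 0%N)).
    rewrite left_halvesP//; apply/orP; left; apply/asboolP; split=> //.
    by rewrite -g1; move: c01; rewrite c0; case: (contains D' (g 1%N)).
  apply/orP; right; rewrite -(oppositeK hS HD'); apply: map_f.
  rewrite left_halvesP//; apply/asboolP.
  split; rewrite -?g1 ?contains_opposite//.
    exact: half_space_opposite.
  by move: c01; rewrite (negPf c0); case: (contains D' (g 1%N)).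
have -> : geometric_cocycle R S x =
    \sum_(D <- r | D \in H) (mkmalgU D (c D) : free).
  rewrite cE; apply: fsbigE; first exact: undup_uniq.
    move=> D' /=; rewrite mem_undup mem_cat => /orP[|/mapP[D'' + ->]];
    rewrite left_halvesP// => /asboolP[HD _ _]//.
    exact: half_space_opposite.
  move=> D' HD' Dr; have [->|/(rP _ HD')] := eqVneq (c D') 0.
    by rewrite raddf0.
  by rewrite (negPf Dr).
rewrite raddf_sum /=; case: asboolP => HD; last first.
  rewrite big1 => // D'; rewrite inE mcoeffU; case: eqP => // -> /HD.
  by [].
rewrite -/(c D).
have z D' : D' != D -> mcoeff D (mkmalgU D' (c D') : free) = 0.
  by rewrite mcoeffU => /negPf ->.
have [Dr|Dr] := boolP (D \in r).
  have DH : D \in H by rewrite inE.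
  rewrite -big_filter (bigD1_seq D) ?filter_uniq ?undup_uniq//=; last first.
    by rewrite mem_filter DH.
  by rewrite mcoeffUU big1 ?addr0// => D'; exact: z.
rewrite big1_seq => [|D' /andP[_ D'r]].
  by apply/esym/eqP; apply: contraNT Dr; exact: rP.
by apply: z; apply: contraNneq Dr => <-.
Qed.

End SignedModule.

Section SignedBasis.
Variables (R : realType) (W : groupType) (S : set W).
Hypothesis hS : coxeter_system S.
Variables (n : nat) (n_gt0 : (0 < n)%N).
Local Notation half := (@root_half R W S).
Local Notation H := (@half_spaces R W S).
Local Notation free := (free_sets R S).
Local Notation hset := (set (dual_space R S)).
Local Notation opp := (@opposite R W S).
Implicit Types (D : hset) (x y : free) (w : W).

(** The vertices of the simplex attached to a tuple: [1], [x_1], [x_1 x_2],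
    and so on. *)
Definition vertices (x : n.-tuple W) i : W := (\prod_(y <- take i x) y)%g.

Lemma vertices0 (x : n.-tuple W) : vertices x 0 = 1%g.
Proof. by rewrite /vertices take0 big_nil. Qed.

Lemma verticesS (x : n.-tuple W) (i : 'I_n) :
  vertices x i.+1 = (vertices x i * tnth x i)%g.
Proof.
rewrite /vertices (take_nth 1%g) ?size_tuple// -cats1 big_cat big_seq1.
by rewrite (tnth_nth 1%g).
Qed.

Lemma signed_eq x y :
  x \in @signed_pred R W S n -> y \in @signed_pred R W S n ->
  (forall D, H D -> contains D 1%g -> mcoeff D x = mcoeff D y) -> x = y.
Proof.
move=> /(signedP hS)[xH sx] /(signedP hS)[yH sy] xy; apply/malgP => D.
have [HD|HD] := pselect (H D); last first.
  have out z : half_supported z -> mcoeff D z = 0.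
    by move=> zH; apply: mcoeff_outdom; apply/negP => /zH.
  by rewrite !out.
have [D1|D1] := boolP (contains D 1%g); first exact: xy.
have HoD := half_space_opposite hS HD.
by rewrite -(oppositeK hS HD) sx// sy// xy// contains_opposite.
Qed.

Lemma geometric_signed (x : n.-tuple W) :
  geometric_cocycle R S x \in @signed_pred R W S n.
Proof.
apply/(signedP hS); split=> [D|D HD].
  by rewrite -mcoeff_neq0 mcoeff_geometric//; case: asboolP; rewrite ?eqxx.
have HoD := half_space_opposite hS HD.
rewrite !mcoeff_geometric//; do 2 case: asboolP => // _.
rewrite mulrC -alt_prodN; apply: eq_bigr => i _.
by rewrite !contains_opposite.
Qed.

Lemma mcoeff_geometric1 (x : n.-tuple W) D : H D -> contains D 1%g ->
  mcoeff D (geometric_cocycle R S x) =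
  if alternates n D (vertices x) 0 then (-1) ^+ n./2 else 0.
Proof.
move=> HD D1; rewrite mcoeff_geometric//; case: asboolP => // _.
by rewrite (@alt_prodE (fun i => contains D (vertices x i))) ?vertices0.
Qed.

(** The element [D + (-1)^n opposite D] of the signed module. *)
Definition signed_half D : free :=
  mkmalgU D 1 + mkmalgU (opposite D) ((-1) ^+ n).

Lemma mcoeff_signed_half D D' : H D -> H D' -> contains D 1%g ->
  contains D' 1%g -> mcoeff D' (signed_half D) = (D == D')%:R.
Proof.
move=> HD HD' D1 D1'; rewrite mcoeffD !mcoeffU.
have /negPf -> : opposite D != D'.
  by apply: contraTneq D1' => <-; rewrite contains_opposite// D1.
by rewrite addr0.
Qed.

Lemma signed_half_signed D : H D -> signed_half D \in @signed_pred R W S n.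
Proof.
move=> HD; have HoD := half_space_opposite hS HD.
apply/(signedP hS); split=> [D'|D' HD'].
  have [<-//|nD] := eqVneq D D'; have [<-//|noD] := eqVneq (opposite D) D'.
  by rewrite -mcoeff_neq0 mcoeffD !mcoeffU (negPf nD) (negPf noD) addr0 eqxx.
have oE : (opposite D == opposite D') = (D == D').
  by apply/eqP/eqP => [/(congr1 opp)|->//]; rewrite !oppositeK.
rewrite !mcoeffD !mcoeffU oE mulrDl addrC.
have -> : (D == opposite D') = (opposite D == D').
  by apply/eqP/eqP => [->|<-]; rewrite oppositeK.
by case: (D == D') (opposite D == D') => -[];
  rewrite ?mulr1n ?mulr0n ?mul1r ?mul0r//; rewrite -signr_odd; case: (odd n).
Qed.

Lemma geometric_nseq s :
  geometric_cocycle R S [tuple of nseq n (val s)] =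
  signed_half (half 1%g s) *~ (-1) ^+ n./2.
Proof.
have Hs := half_space_root R hS 1%g s.
have s1 := contains_root_half_id R hS 1%g s.
have ns1 : ~~ contains (half 1%g s) (val s).
  by rewrite -[val s]mul1g contains_root_halfN_id.
apply: signed_eq; first exact: geometric_signed.
  by rewrite rpredMz ?signed_half_signed.
move=> D HD D1; rewrite mcoeff_geometric1//.
have -> : mcoeff D (signed_half (half 1%g s) *~ (-1) ^+ n./2) =
    (half 1%g s == D)%:R * (-1) ^+ n./2.
  rewrite -(mcoeff_signed_half Hs HD s1 D1) -signr_odd.
  by case: odd; rewrite ?expr1 ?expr0 ?mulrN1z ?mulr1z ?mcoeffN ?mulrN1 ?mulr1.
have vE i : (i <= n)%N -> vertices [tuple of nseq n (val s)] i =
    if odd i then val s else 1%g.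
  elim: i => [|i IH] lin; first by rewrite vertices0.
  rewrite (@verticesS _ (Ordinal lin)) IH ?(ltnW lin)//.
  rewrite (tnth_nth 1%g) /= nth_nseq lin.
  by case: odd; rewrite /= ?gen_sqr ?mul1g.
have [<-|sD] := eqVneq (half 1%g s) D.
  rewrite mul1r; case: ifPn => // /negP[]; apply/allP => i.
  rewrite mem_iota subn0 => /andP[_ lin]; rewrite vE//.
  by case: odd; rewrite ?s1 ?(negPf ns1).
rewrite mul0r alternatesE// alternatesE// !vE//= D1 /=.
have -> : contains D (val s).
  apply: contraT => nD; case/eqP: sD; apply/esym.
  apply: half_space_adjacent => //.
  by rewrite mul1g.
by [].
Qed.

Lemma free_act_signed_half w s : free_act w (signed_half (half 1%g s)) =
  signed_half (half w s).
Proof.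
have -> : half w s = dual_act w @` half 1%g s.
  by rewrite dual_act_root_half// mulg1.
rewrite /free_act /signed_half free_mapD !free_mapU opposite_act//.
exact: half_space_root.
Qed.

(** The support of an element of the signed module is stable under the exchange
    of a half-space and its opposite. *)
Lemma sum_opposite (V : zmodType) x (P : pred hset) (f : hset -> V) :
  x \in @signed_pred R W S n ->
  \sum_(D <- msupp x | P D) f D =
  \sum_(D <- msupp x | P (opposite D)) f (opposite D).
Proof.
move=> /(signedP hS)[xH sx].
rewrite -(big_map opp P f); apply: perm_big; apply: uniq_perm.
- exact: fset_uniq.
- rewrite map_inj_in_uniq ?fset_uniq// => D D' /xH HD /xH HD' /(congr1 opp).
  by rewrite !oppositeK.
have sub D : D \in msupp x -> opposite D \in msupp x.
  move=> Dx; have HD := xH _ Dx.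
  by rewrite -mcoeff_neq0 sx// mulf_neq0 ?signr_eq0// mcoeff_neq0.
move=> D; apply/idP/mapP => [Dx|[D' D'x ->]]; last exact: sub.
by exists (opposite D); rewrite ?sub ?oppositeK//; exact: xH.
Qed.

End SignedBasis.

(** * The factorization *)

Section Factorization.
Variables (R : realType) (W : groupType) (S : set W).
Hypothesis hS : coxeter_system S.
Variables (A : zmodType) (act : W -> A -> A).
Hypothesis hact : group_module act.
Variables (n : nat) (zeta : n.-tuple W -> A).
Hypothesis n_gt1 : (1 < n)%N.
Hypotheses (hzeta : cocycle act zeta) (hcol : collapsing S zeta).
Local Notation half := (@root_half R W S).
Local Notation H := (@half_spaces R W S).
Local Notation hset := (set (dual_space R S)).
Local Notation signed := (signed_half_spaces R S n).
Local Notation hval := (@half_val R W S A act n zeta).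
Implicit Types (D : hset) (w : W).

Let n_gt0 : (0 < n)%N := ltnW n_gt1.

(** The sum over the half-spaces containing the fundamental chamber takes one
    half-space in each pair of opposite ones; the sign is the coefficient of
    such a half-space in the geometric cocycle when all the vertices alternate
    about its wall. *)
Definition wall_map (x : free_sets R S) : A :=
  free_ext (fun D => if contains D 1%g then hval D else 0) x *~ (-1) ^+ n./2.

Lemma wall_mapB : {morph wall_map : x y / x - y}.
Proof. by move=> x y; rewrite /wall_map free_extB mulrzBl. Qed.

Lemma homog_vertices (x : n.-tuple W) : homog act zeta (vertices x) = zeta x.
Proof.
rewrite /homog vertices0 (act1 hact); congr zeta.
by apply: eq_from_tnth => i; rewrite tnth_mktuple verticesS mulKg.
Qed.

Lemma wall_map_geometric (x : n.-tuple W) :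
  wall_map (geometric_cocycle R S x) = zeta x.
Proof.
rewrite -homog_vertices; set g := vertices x.
have [ws red g1] := reduced_wordP hS (g 0%N) (g 1%N).
have g0 : g 0%N = 1%g by exact: vertices0.
rewrite (homog_half R hS hact n_gt1 hzeta hcol red g1) /wall_map.
have [xH _] := (signedP hS n _).1 (geometric_signed R hS n_gt0 x).
rewrite (@free_extE _ _ _ _ (left_halves R (g 0%N) ws)); last 2 first.
- exact: left_halves_uniq.
- move=> D; case: ifP => [D1 _ Dx|]; last by rewrite eqxx.
  rewrite left_halvesP// -g1 g0; apply/asboolP; split=> //; first exact: xH.
  move: (Dx); rewrite -mcoeff_neq0 mcoeff_geometric1//; last exact: xH.
  case: ifP => [|_]; last by rewrite eqxx.
  by rewrite alternatesE// alternatesE// => /and3P[_ /eqP ->].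
rewrite mulrz_suml; apply: eq_big_seq => D.
rewrite left_halvesP// -g1 g0 => /asboolP[HD D1 nD].
rewrite D1 mcoeff_geometric1// alternatesE// alternatesE// -/g.
rewrite g0 D1 (negPf nD) /=.
case: ifP => _; last by rewrite mulr0z mul0rz.
by rewrite -mulrzA -signr_odd -expr2 sqrr_sign mulr1z.
Qed.

(** The sum that defines [wall_map] could be taken over the half-spaces that
    contain any given chamber. *)
Lemma wall_map_chamber (x : free_sets R S) w : x \in @signed_pred R W S n ->
  \sum_(D <- msupp x | contains D w) hval D *~ mcoeff D x =
  \sum_(D <- msupp x | contains D 1%g) hval D *~ mcoeff D x.
Proof.
move=> xs; have [xH sx] := (signedP hS n x).1 xs.
rewrite (bigID (fun D => contains D 1%g)).
rewrite [RHS](bigID (fun D => contains D w)) /=.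
congr (_ + _); first by apply: eq_bigl => D; rewrite andbC.
rewrite (sum_opposite hS _ _ xs) big_seq_cond [RHS]big_seq_cond.
apply: eq_big => [D|D /andP[/xH HD _]].
  case: (boolP (D \in msupp x)) => // /xH HD.
  by rewrite /= !contains_opposite// negbK andbC.
rewrite (half_val_opposite hS hact n_gt1 hzeta hcol HD) sx// -mulrzA.
by rewrite mulrCA -signr_odd -expr2 sqrr_sign mulr1.
Qed.

Lemma wall_map_act w (x : free_sets R S) : x \in @signed_pred R W S n ->
  wall_map (free_act w x) = act w (wall_map x).
Proof.
move=> xs; have [xH sx] := (signedP hS n x).1 xs.
rewrite /wall_map (actMz hact); congr (_ *~ _).
have extE (v : W) :
    \sum_(D <- msupp x) (if contains D v then hval D else 0) *~ mcoeff D x =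
    \sum_(D <- msupp x | contains D v) hval D *~ mcoeff D x.
  rewrite [RHS]big_mkcond; apply: eq_bigr => D _.
  by case: ifP => // _; rewrite mul0rz.
rewrite [in RHS]/free_ext extE -(wall_map_chamber w^-1%g xs) -extE.
rewrite (act_sum hact) /free_act /free_map free_ext_sum.
apply: eq_big_seq => D /xH HD; rewrite free_extU (actMz hact).
rewrite -(mulgV w) (contains_dual_act hS); congr (_ *~ _); case: ifP => _.
  exact: (half_val_act hS hact n_gt1 hzeta hcol).
by rewrite (act0 hact).
Qed.

(** An additive map that is equivariant and through which [zeta] factors is
    determined on the elements [signed_half D], by the tuples [(s, ..., s)]. *)
Lemma factorization_half (b : {additive signed -> A}) p s (y : signed) :
  equivariant act b -> factorization zeta b ->
  val y = signed_half n (half p s) ->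
  b y = act p (zeta [tuple of nseq n (val s)]) *~ (-1) ^+ n./2.
Proof.
move=> eqv fact yE; have [y1 y1E ->] := fact [tuple of nseq n (val s)].
have [y2 y2E <-] := eqv p y1.
rewrite -raddfMz; congr (b _); apply: val_inj.
rewrite raddfMz /= y2E y1E geometric_nseq// /free_act free_map_Mz.
rewrite -/(free_act _ _) free_act_signed_half// -yE -mulrzA -signr_odd -expr2.
by rewrite sqrr_sign mulr1z.
Qed.

Lemma signed_decomposition (u : signed) : exists2 e : hset -> signed,
  forall D, H D -> signed_val (e D) = signed_half n D
  & u = \sum_(D <- msupp (val u) | contains D 1%g) e D *~ mcoeff D (val u).
Proof.
pose e D : signed := insubd 0 (signed_half n D).
have eE D : H D -> signed_val (e D) = signed_half n D.
  by move=> HD; apply: insubdK; exact: signed_half_signed.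
exists e => //; have us := signed_valP u.
have [uH _] := (signedP hS n _).1 us.
apply: val_inj; apply: (signed_eq hS us (signed_valP _)).
move=> D HD D1; rewrite -[X in _ = mcoeff D X]/(val _) raddf_sum raddf_sum /=.
have term D' : D' \in msupp (val u) -> contains D' 1%g ->
    mcoeff D (val (e D' *~ mcoeff D' (val u))) =
    mcoeff D' (val u) *+ (D' == D).
  move=> /uH HD' D'1; rewrite raddfMz /= eE// raddfMz /= mcoeff_signed_half//.
  by case: (D' == D); [rewrite intz | rewrite mul0rz].
rewrite [RHS]big_seq_cond.
rewrite (eq_bigr (fun D' => mcoeff D' (val u) *+ (D' == D))); last first.
  by move=> D' /andP[]; exact: term.
rewrite -big_seq_cond; case: (boolP (D \in msupp (val u))) => Du; last first.
  rewrite mcoeff_outdom// big1_seq// => D' /andP[_ D'u].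
  by case: eqP D'u Du => [-> ->|].
rewrite -big_filter (bigD1_seq D) ?filter_uniq ?fset_uniq ?mem_filter ?D1//=.
by rewrite eqxx big1 ?addr0// => D' /negPf ->.
Qed.

Lemma factorization_unique (b1 b2 : {additive signed -> A}) :
  equivariant act b1 -> factorization zeta b1 ->
  equivariant act b2 -> factorization zeta b2 -> b1 =1 b2.
Proof.
move=> e1 f1 e2 f2 u; have [e eE ->] := signed_decomposition u.
have [uH _] := (signedP hS n _).1 (signed_valP u).
rewrite !raddf_sum big_seq_cond [RHS]big_seq_cond; apply: eq_bigr => D.
move=> /andP[/uH HD _]; rewrite !raddfMz; congr (_ *~ _).
have := eE D HD; have /(half_spacesP hS)[p [s ->]] := HD => eD.
by rewrite (factorization_half e1 f1 eD) (factorization_half e2 f2 eD).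
Qed.

End Factorization.

Theorem theorem2p9 (R : realType) (W : groupType) (S : set W)
    (hS : coxeter_system S) (n : nat) (hn : (2 <= n)%N)
    (A : zmodType) (act : W -> A -> A) (hact : group_module act)
    (zeta : n.-tuple W -> A) (hzeta : cocycle act zeta)
    (hcol : collapsing S zeta) :
  exists a : {additive signed_half_spaces R S n -> A},
    (equivariant act a /\ factorization zeta a) /\
    (forall b : {additive signed_half_spaces R S n -> A},
        equivariant act b /\ factorization zeta b -> b =1 a).
Proof.
pose f (x : signed_half_spaces R S n) := wall_map act zeta (val x).
have fB : {morph f : x y / x - y}.
  by move=> x y; rewrite /f raddfB wall_mapB.
pose a : {additive signed_half_spaces R S n -> A} :=
  HB.pack f (GRing.isZmodMorphism.Build _ _ f fB).
have a_eqv : equivariant act a.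
  move=> w u; exists (SignedHalfSpaces (signed_act hS w (signed_valP u))) => //.
  exact: wall_map_act (signed_valP u).
have a_fact : factorization zeta a.
  move=> x; exists (SignedHalfSpaces (geometric_signed R hS (ltnW hn) x)) => //.
  by rewrite /a /= /f wall_map_geometric.
exists a; split=> // b [b_eqv b_fact].
exact: factorization_unique b_eqv b_fact a_eqv a_fact.
Qed.
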